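(* Let $E$ and $F$ be Banach spaces. Assume $E^*$ does not have the Schur property, $E^{**}$ contains no complemented copy of $\ell_1$, and $F^*$ contains a complemented copy of $\ell_1$. Then $(E\widehat{\otimes}_\pi F)^*$ does not have the Dunford-Pettis property.
   Context: $E\widehat{\otimes}_\pi F$ is the (completed) projective tensor product of $E$ and $F$. $E^*$, $E^{**}$ denote the dual and bidual of $E$. An operator (bounded linear map) is completely continuous if it takes weak Cauchy sequences into norm Cauchy sequences. A Banach space $E$ has the Dunford-Pettis property if every weakly compact operator from $E$ into any Banach space is completely continuous; equivalently, $\lim_n\phi_n(x_n)=0$ for all weakly null sequences $(x_n)\subset E$ and $(\phi_n)\subset E^*$. A Banach space has the Schur property if every weakly convergent sequence in it converges in norm. A Banach space contains a complemented copy of $\ell_1$ if it has a closed subspace that is isomorphic (linearly homeomorphic) to $\ell_1$ and is the range of a bounded linear projection on the whole space. *)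

(* Defs.v *)
From HB Require Import structures.
From mathcomp Require Import all_boot all_order all_algebra.
From mathcomp Require Import sesquilinear complex.
From mathcomp Require Import all_classical all_reals all_analysis.

Set Implicit Arguments.
Unset Strict Implicit.
Unset Printing Implicit Defensive.

Import Order.TTheory GRing.Theory Num.Theory.
Import numFieldNormedType.Exports.

Local Open Scope classical_set_scope.
Local Open Scope ring_scope.

(* Banach spaces are taken over R or C: all notions below are stated over
   [scalar_field R s], which is R or R[i] according to [s].  Norms take values
   in the scalar field; [rnorm] is the same norm as an element of R. *)

Variant scalars := RealScalars | ComplexScalars.

Definition scalar_field (R : realType) (s : scalars) : numFieldType :=
  match s with
  | RealScalars => R
  | ComplexScalars => R[i]
  end.

Definition real_part (R : realType) (s : scalars) : scalar_field R s -> R :=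
  match s with
  | RealScalars => id
  | ComplexScalars => @complex.Re R
  end.

Definition of_real (R : realType) (s : scalars) : R -> scalar_field R s :=
  match s with
  | RealScalars => id
  | ComplexScalars => real_complex R
  end.

Section ScalarFields.
Variables (R : realType) (s : scalars).
Local Notation K := (scalar_field R s).

Lemma real_partK (k : K) : 0 <= k -> of_real s (real_part k) = k.
Proof.
rewrite /of_real /real_part; case: s k => //= k; rewrite lecE /= => /andP[/eqP].
by case: k => a b /= ->.
Qed.

Lemma real_partD (k l : K) : real_part (k + l) = real_part k + real_part l.
Proof. by rewrite /real_part; case: s k l => //= -[a b] [c d]. Qed.

Lemma real_partM (k l : K) : 0 <= k -> 0 <= l ->
  real_part (k * l) = real_part k * real_part l.
Proof.
rewrite /real_part; case: s k l => //= -[a b] [c d].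
rewrite !lecE /= => /andP[/eqP-> _] /andP[/eqP-> _].
by rewrite mulr0 subr0.
Qed.

Lemma real_part_le (k l : K) : k <= l -> real_part k <= real_part l.
Proof.
by rewrite /real_part; case: s k l => //= k l; rewrite lecE => /andP[].
Qed.

Lemma real_part0 : real_part (0 : K) = 0.
Proof. by rewrite /real_part; case: s. Qed.

Lemma of_real0 : of_real s 0 = 0 :> K.
Proof. by rewrite /of_real; case: s. Qed.

Lemma of_realK : cancel (of_real s) (@real_part R s).
Proof. by rewrite /of_real /real_part; case: s. Qed.

Lemma of_realD (x y : R) : of_real s (x + y) = of_real s x + of_real s y.
Proof. by rewrite /of_real; case: s => //; rewrite rmorphD. Qed.

Lemma of_realM (x y : R) : of_real s (x * y) = of_real s x * of_real s y.
Proof. by rewrite /of_real; case: s => //; rewrite rmorphM. Qed.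

Lemma ler_of_real (x y : R) : (of_real s x <= of_real s y) = (x <= y).
Proof. by rewrite /of_real; case: s => //; rewrite lecR. Qed.

End ScalarFields.

Definition rnorm (R : realType) (s : scalars)
  (V : normedModType (scalar_field R s)) (x : V) : R := real_part `|x|.

Section RealNorm.
Variables (R : realType) (s : scalars) (V : normedModType (scalar_field R s)).
Local Notation K := (scalar_field R s).

Lemma of_real_rnorm (x : V) : of_real s (rnorm x) = `|x|.
Proof. exact: real_partK. Qed.

Lemma rnorm_ge0 (x : V) : 0 <= rnorm x.
Proof. by rewrite -(real_part0 R s); exact: real_part_le. Qed.

Lemma ler_rnormD (x y : V) : rnorm (x + y) <= rnorm x + rnorm y.
Proof. by rewrite /rnorm -real_partD; apply: real_part_le; exact: ler_normD. Qed.

Lemma rnormZ (k : K) (x : V) : rnorm (k *: x) = rnorm (k : K^o) * rnorm x.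
Proof. by rewrite /rnorm normrZ real_partM. Qed.

Lemma rnorm0 : rnorm (0 : V) = 0.
Proof. by rewrite /rnorm normr0 real_part0. Qed.

Lemma rnorm_eq0 (x : V) : rnorm x = 0 -> x = 0.
Proof. by move=> x0; apply/normr0_eq0; rewrite -of_real_rnorm x0 of_real0. Qed.

End RealNorm.

Lemma continuous_linear_rnorm (R : realType) (s : scalars)
    (V W : normedModType (scalar_field R s)) (f : {linear V -> W}) :
  continuous f -> exists2 M : R, 0 <= M & forall x, rnorm (f x) <= M * rnorm x.
Proof.
move=> /linear_bounded_continuous /linear_boundedP /pinfty_ex_gt0[M M0 fM].
have M0' := ltW M0.
exists (real_part M); first by rewrite -(real_part0 R s); exact: real_part_le.
by move=> x; rewrite /rnorm -real_partM//; exact: real_part_le.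
Qed.

Section Dual.
Variables (R : realType) (s : scalars) (E : normedModType (scalar_field R s)).
Local Notation K := (scalar_field R s).

Definition dual_pred : pred (E -> K^o) :=
  fun f => `[< linear f /\ continuous f >].

Record dual := Dual {
  dual_fun :> E -> K^o;
  dual_funP : dual_pred dual_fun }.

HB.instance Definition _ := [isSub for dual_fun].
HB.instance Definition _ := [Choice of dual by <:].

Lemma dual_subsemimod_closed : subsemimod_closed dual_pred.
Proof.
split; [split|].
- apply/asboolP; split; first by move=> k x y /=; rewrite scaler0 addr0.
  by move=> x; exact: cvg_cst.
- move=> f g /asboolP[lf cf] /asboolP[lg cg]; apply/asboolP; split.
    move=> k x y; rewrite !fctE lf lg scalerDr.
    by rewrite addrACA.
  by move=> x; apply: continuousD; [exact: cf|exact: cg].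
- move=> k f /asboolP[lf cf]; apply/asboolP; split.
    by move=> l x y; rewrite !fctE lf scalerDr !scalerA mulrC.
  by move=> x; apply: continuousZl_tmp; exact: cf.
Qed.

HB.instance Definition _ := GRing.SubChoice_isSubLmodule.Build K (E -> K^o)
  dual_pred dual dual_subsemimod_closed.

Lemma dual_linear (f : dual) : linear f.
Proof. by have /asboolP[] := dual_funP f. Qed.

HB.instance Definition _ (f : dual) :=
  GRing.isLinear.Build K E K^o *:%R (dual_fun f) (dual_linear f).

Lemma dual_continuous (f : dual) : continuous f.
Proof. by have /asboolP[] := dual_funP f. Qed.

Lemma dualDE (f g : dual) x : (f + g) x = f x + g x.
Proof. by []. Qed.

Lemma dualZE k (f : dual) x : (k *: f) x = k *: f x.
Proof. by []. Qed.

Lemma dual_eq (f g : dual) : f =1 g -> f = g.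
Proof. by move=> fg; apply/val_inj/funext. Qed.

Definition dual_rnorm (f : dual) : R :=
  sup [set rnorm (f x) | x in [set x : E | `|x| <= 1]].

Lemma ball_rnorm (x : E) : (`|x| <= 1) = (rnorm x <= 1).
Proof.
rewrite -of_real_rnorm.
have -> : 1 = of_real s 1 :> K by rewrite /of_real; case: s.
exact: ler_of_real.
Qed.

Lemma dual_rnorm_has_sup (f : dual) :
  has_sup [set rnorm (f x) | x in [set x : E | `|x| <= 1]].
Proof.
split; first by exists (rnorm (f 0)), 0 => //=; rewrite normr0 ler01.
have [M M0 fM] := continuous_linear_rnorm (@dual_continuous f).
exists M => _ [x /= x1 <-]; apply: le_trans (fM x) _.
by rewrite -[leRHS]mulr1 ler_wpM2l// -ball_rnorm.
Qed.

Lemma dual_rnorm_ub (f : dual) x : `|x| <= 1 -> rnorm (f x) <= dual_rnorm f.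
Proof.
move=> x1; apply: sup_upper_bound; first exact: dual_rnorm_has_sup.
by exists x.
Qed.

Lemma dual_rnorm_le (f : dual) M :
  (forall x, `|x| <= 1 -> rnorm (f x) <= M) -> dual_rnorm f <= M.
Proof.
move=> fM; apply: sup_le_ub; first by have [] := dual_rnorm_has_sup f.
by move=> _ [x x1 <-]; exact: fM.
Qed.

Lemma dual_rnorm_ge0 (f : dual) : 0 <= dual_rnorm f.
Proof.
apply: le_trans (dual_rnorm_ub f (x := 0) _); first exact: rnorm_ge0.
by rewrite normr0.
Qed.

Lemma ler_dual_rnormD (f g : dual) :
  dual_rnorm (f + g) <= dual_rnorm f + dual_rnorm g.
Proof.
apply: dual_rnorm_le => x x1; rewrite dualDE.
by rewrite (le_trans (ler_rnormD _ _))// lerD// dual_rnorm_ub.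
Qed.

Lemma dual_rnormZ_le (k : K) (f : dual) :
  dual_rnorm (k *: f) <= rnorm (k : K^o) * dual_rnorm f.
Proof.
apply: dual_rnorm_le => x x1; rewrite dualZE rnormZ.
by rewrite ler_wpM2l ?rnorm_ge0// dual_rnorm_ub.
Qed.

Lemma dual_rnormZ (k : K) (f : dual) :
  dual_rnorm (k *: f) = rnorm (k : K^o) * dual_rnorm f.
Proof.
apply/eqP; rewrite eq_le dual_rnormZ_le /=.
have [->|k0] := eqVneq k 0.
  by rewrite (rnorm0 (K^o : normedModType K)) mul0r dual_rnorm_ge0.
have h : rnorm (k : K^o) * rnorm (k^-1 : K^o) = 1.
  rewrite -rnormZ /GRing.scale /= mulfV// /rnorm normr1.
  by rewrite /real_part; case: s.
have := dual_rnormZ_le k^-1 (k *: f).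
rewrite scalerA mulVf// scale1r => /(ler_wpM2l (rnorm_ge0 (k : K^o))).
by rewrite mulrA h mul1r.
Qed.

Lemma dual_rnorm_eq0 (f : dual) : dual_rnorm f = 0 -> f = 0.
Proof.
move=> f0; apply: dual_eq => x; change (f x = 0).
have [->|x0] := eqVneq x 0; first by rewrite linear0.
have nx0 : `|x| != 0 by rewrite normr_eq0.
have : rnorm (f (`|x|^-1 *: x)) = 0.
  apply/eqP; rewrite eq_le rnorm_ge0 andbT -f0 dual_rnorm_ub//.
  by rewrite normrZ normfV normr_id mulVf.
move=> /rnorm_eq0; rewrite linearZ /= => /eqP; rewrite scaler_eq0 invr_eq0.
by rewrite (negPf nx0) /= => /eqP.
Qed.

Lemma dual_ler_normD (f g : dual) :
  of_real s (dual_rnorm (f + g))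
    <= of_real s (dual_rnorm f) + of_real s (dual_rnorm g) :> K.
Proof. by rewrite -of_realD ler_of_real ler_dual_rnormD. Qed.

Lemma dual_normrZ (k : K) (f : dual) :
  of_real s (dual_rnorm (k *: f)) = `|k| * of_real s (dual_rnorm f).
Proof.
by rewrite dual_rnormZ of_realM (of_real_rnorm (k : K^o)).
Qed.

Lemma dual_normr0_eq0 (f : dual) : of_real s (dual_rnorm f) = 0 :> K -> f = 0.
Proof.
move=> /(congr1 (@real_part R s)); rewrite of_realK real_part0.
exact: dual_rnorm_eq0.
Qed.

HB.instance Definition _ := Lmodule_isNormed.Build K dual
  dual_ler_normD dual_normrZ dual_normr0_eq0.

Lemma rnorm_dualE (f : dual) :
  rnorm f = sup [set rnorm (f x) | x in [set x : E | `|x| <= 1]].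
Proof. exact: of_realK. Qed.

End Dual.

Section Ell1.
Variables (R : realType) (s : scalars).
Local Notation K := (scalar_field R s).

Definition ell1_pred : pred (nat -> K^o) :=
  fun a => `[< cvgn (series (fun n => rnorm (a n))) >].

Record ell1 := Ell1 {
  ell1_fun :> nat -> K^o;
  ell1_funP : ell1_pred ell1_fun }.

HB.instance Definition _ := [isSub for ell1_fun].
HB.instance Definition _ := [Choice of ell1 by <:].

Lemma series_rnormZ (k : K) (a : nat -> K^o) :
  (fun n => rnorm (k *: a n)) = rnorm (k : K^o) *: (fun n => rnorm (a n)) :> (R^o)^nat.
Proof. by apply/funext => n; rewrite rnormZ. Qed.

Lemma ell1_subsemimod_closed : subsemimod_closed ell1_pred.
Proof.
split; [split|].
- apply/asboolP; have -> : series (fun n => rnorm ((0 : nat -> K^o) n)) = cst 0.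
    by apply/funext => n; rewrite /series/= big1// => i _; rewrite rnorm0.
  exact: is_cvg_cst.
- move=> a b /asboolP ca /asboolP cb; apply/asboolP.
  apply: (@series_le_cvg _ _ (fun n => rnorm (a n) + rnorm (b n))).
  + by move=> n; exact: rnorm_ge0.
  + by move=> n; rewrite addr_ge0// rnorm_ge0.
  + by move=> n; exact: ler_rnormD.
  + exact: (is_cvg_seriesD ca cb).
- move=> k a /asboolP ca; apply/asboolP.
  by rewrite series_rnormZ; exact: is_cvg_seriesZ.
Qed.

HB.instance Definition _ := GRing.SubChoice_isSubLmodule.Build K (nat -> K^o)
  ell1_pred ell1 ell1_subsemimod_closed.

Lemma ell1_cvg (a : ell1) : cvgn (series (fun n => rnorm (a n))).
Proof. by have /asboolP := ell1_funP a. Qed.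

Definition ell1_rnorm (a : ell1) : R := limn (series (fun n => rnorm (a n))).

Lemma ler_ell1_rnormD (a b : ell1) :
  ell1_rnorm (a + b) <= ell1_rnorm a + ell1_rnorm b.
Proof.
have cab := is_cvg_seriesD (@ell1_cvg a) (@ell1_cvg b).
rewrite /ell1_rnorm -(lim_seriesD (@ell1_cvg a) (@ell1_cvg b)).
by apply: lim_series_le => //; [exact: ell1_cvg|move=> n; exact: ler_rnormD].
Qed.

Lemma ell1_rnormZ (k : K) (a : ell1) :
  ell1_rnorm (k *: a) = rnorm (k : K^o) * ell1_rnorm a.
Proof.
by rewrite /ell1_rnorm series_rnormZ (lim_seriesZ _ (@ell1_cvg a)).
Qed.

Lemma ell1_rnorm_eq0 (a : ell1) : ell1_rnorm a = 0 -> a = 0.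
Proof.
move=> a0; apply/val_inj/funext => n; change (a n = 0); apply: rnorm_eq0.
apply/eqP; rewrite eq_le rnorm_ge0 andbT -a0.
have nd : nondecreasing_seq (series (fun n => rnorm (a n))).
  apply/nondecreasing_seqP => m.
  by rewrite /series/= big_nat_recr//= lerDl rnorm_ge0.
apply: le_trans (nondecreasing_cvgn_le nd (@ell1_cvg a) n.+1).
rewrite /series/= big_nat_recr//= lerDr.
by apply: sumr_ge0 => i _; exact: rnorm_ge0.
Qed.

Lemma ell1_ler_normD (a b : ell1) :
  of_real s (ell1_rnorm (a + b))
    <= of_real s (ell1_rnorm a) + of_real s (ell1_rnorm b) :> K.
Proof. by rewrite -of_realD ler_of_real ler_ell1_rnormD. Qed.

Lemma ell1_normrZ (k : K) (a : ell1) :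
  of_real s (ell1_rnorm (k *: a)) = `|k| * of_real s (ell1_rnorm a).
Proof. by rewrite ell1_rnormZ of_realM (of_real_rnorm (k : K^o)). Qed.

Lemma ell1_normr0_eq0 (a : ell1) : of_real s (ell1_rnorm a) = 0 :> K -> a = 0.
Proof.
move=> /(congr1 (@real_part R s)); rewrite of_realK real_part0.
exact: ell1_rnorm_eq0.
Qed.

HB.instance Definition _ := Lmodule_isNormed.Build K ell1
  ell1_ler_normD ell1_normrZ ell1_normr0_eq0.

Lemma rnorm_ell1E (a : ell1) : rnorm a = limn (series (fun n => rnorm (a n))).
Proof. exact: of_realK. Qed.

End Ell1.

Section BanachSpaceNotions.
Variables (R : realType) (s : scalars).
Local Notation K := (scalar_field R s).

Definition weak_cvg (E : normedModType K) (u : nat -> E) (x : E) :=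
  forall f : dual E, (fun n => f (u n)) @ \oo --> f x.

Definition weak_cauchy (E : normedModType K) (u : nat -> E) :=
  forall f : dual E, cauchy ((fun n => f (u n)) @ \oo).

(* The set of points of [E] with the coarsest topology making every element
   of the dual of [E] continuous. *)
Definition weak_space (E : normedModType K) : Type :=
  initial_topology (fun x : E => (fun f => f x) : {ptws dual E -> K^o}).

HB.instance Definition _ (E : normedModType K) :=
  Topological.on (weak_space E).

Definition schur (E : normedModType K) :=
  forall (u : nat -> E) (x : E), weak_cvg u x -> u @ \oo --> x.

Definition weakly_compact_op (E F : normedModType K) (T : {linear E -> F}) :=
  precompact (T @` [set x | `|x| <= 1] : set (weak_space F)).

Definition completely_continuous (E F : normedModType K)
    (T : {linear E -> F}) :=
  forall u : nat -> E, weak_cauchy u -> cauchy ((fun n => T (u n)) @ \oo).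

Definition dunford_pettis (E : normedModType K) :=
  forall (F : completeNormedModType K) (T : {linear E -> F}),
    continuous T -> weakly_compact_op T -> completely_continuous T.

(* [M] is the subspace, [T] an isomorphism of [X] onto it with inverse [S]
   (defined on all of [E] but relevant on [M] only), [P] the projection. *)
Definition contains_complemented_copy (X E : normedModType K) :=
  exists (M : set E) (T : {linear X -> E}) (S : E -> X) (P : {linear E -> E}),
    [/\ closed M,
        [/\ range T = M, cancel T S, continuous T & {within M, continuous S}] &
        [/\ range P = M, forall x, P (P x) = P x & continuous P]].

(* A finite sequence of pairs stands for the tensor \sum_i x_i (x) y_i of the
   algebraic tensor product, whose universal property tells when two such
   sequences stand for the same tensor. *)
Definition same_tensor (E F : lmodType K) (t t' : seq (E * F)) :=
  forall (W : lmodType K) (b : {bilinear E -> F -> W}),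
    \sum_(p <- t) b p.1 p.2 = \sum_(p <- t') b p.1 p.2.

Definition projective_norm (E F : normedModType K) (t : seq (E * F)) : R :=
  inf [set \sum_(p <- t') rnorm p.1 * rnorm p.2 | t' in same_tensor t].

(* [G], with the canonical bilinear map [tau] : (x, y) |-> x (x) y, is the
   completion of the algebraic tensor product of [E] and [F] for the
   projective norm: the latter embeds isometrically and densely in [G].  This
   determines the Banach space [G] up to a unique isometric isomorphism
   compatible with [tau]. *)
Record projective_tensor_product (E F G : completeNormedModType K)
    (tau : {bilinear E -> F -> G}) : Prop := {
  ptp_norm : forall t : seq (E * F),
    rnorm (\sum_(p <- t) tau p.1 p.2) = projective_norm t;
  ptp_dense : dense [set \sum_(p <- t) tau p.1 p.2 | t in @setT (seq (E * F))]
}.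

End BanachSpaceNotions.

(* Main.v *)
Require Import Defs.
From HB Require Import structures.
From mathcomp Require Import all_boot all_order all_algebra.
From mathcomp Require Import sesquilinear.
From mathcomp Require Import all_classical all_reals all_analysis.
From mathcomp Require Import complex ring lra.
Import Order.TTheory GRing.Theory Num.Theory.
Import numFieldNormedType.Exports.

Set Implicit Arguments.
Unset Strict Implicit.
Unset Printing Implicit Defensive.

Local Open Scope classical_set_scope.
Local Open Scope ring_scope.

(** Write X' for the dual of X, and D for the dual of the projective tensor
    product of E and F, that is, the space of bounded bilinear forms on E x F.
    It suffices to find a weakly null sequence [g n] in D and a weakly null
    sequence [phi n] in D' with [phi n (g n)] bounded away from 0
    ([not_dunford_pettis]): the operator of coordinates [phi n], with values in
    c0, is then weakly compact, but does not send the weakly null sequence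
    [g n] to a Cauchy sequence.

    The hypotheses provide the ingredients.  As E' is not a Schur space, it
    contains a weakly null sequence [f n] of unit vectors, and there are [x n]
    in the unit ball of E with [|f n (x n)| > 1/2].  A complemented copy of
    ell1 in F' gives a bounded sequence [u n] in F' and functionals [v n] in
    F'' with [v n (u n) = 1] and with [|v n h|] summable, uniformly for [h] in
    the unit ball.  Let [g n] be the form sending (x, y) to [f n x * u n y],
    and let [phi n] send a form [b] to the value of [v n] at the functional
    [b (x n, -)].  Then [phi n (g n) = f n (x n)].

    That [g n] is weakly null ([weakly_null_tensor]) rests on a strengthening
    of Mazur's theorem: for a weakly null sequence of functionals, some convex
    combinations of the moduli of its terms are uniformly small on the unit
    ball ([weakly_null_abs_convex]).  It follows from Simons' inequality
    ([simons]), whose proof is elementary.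

    That [phi n] is weakly null ([weakly_null_contract]) uses the hypothesis on
    E''.  An element xi of D'' acts on the contraction of forms by [v n] and
    defines functionals [Y n] on E'' with [|Y n z|] summable, uniformly for [z]
    in the unit ball, and [Y n (x n) = xi (phi n)].  If these numbers did not
    tend to 0, the operator from E'' to ell1 with coordinates [Y n] would fix a
    copy of ell1 and E'' would contain a complemented copy of it
    ([complemented_ell1_of_functionals], by Rosenthal's lemma [rosenthal] and a
    Neumann series).  In other words, the third dual of E contains no copy of
    c0, and this forces the terms of the weakly unconditionally Cauchy series
    of the [Y n] to tend to 0. *)

(** * Norms with real values *)

Section RealNormComplements.
Variables (R : realType) (s : scalars).
Local Notation K := (scalar_field R s).

Lemma of_real_inj : injective (@of_real R s).
Proof. exact: (can_inj (@of_realK R s)). Qed.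

Lemma ltr_of_real (x y : R) : (of_real s x < of_real s y) = (x < y).
Proof. by rewrite !lt_def ler_of_real (inj_eq of_real_inj). Qed.

Lemma of_real_gt0 (k : K) : 0 < k -> 0 < real_part k.
Proof.
by move=> k0; rewrite -ltr_of_real of_real0 real_partK// ltW.
Qed.

Lemma of_real1 : of_real s 1 = 1 :> K.
Proof. by rewrite /of_real; case: s. Qed.

Lemma rnorm1 : rnorm (1 : K^o) = 1.
Proof. by apply: of_real_inj; rewrite of_real_rnorm normr1 of_real1. Qed.

Lemma rnorm_of_real (x : R) : rnorm (of_real s x : K^o) = `|x|.
Proof.
rewrite /rnorm /of_real /real_part; case: s => //=.
by rewrite expr0n addr0 sqrtr_sqr.
Qed.

Lemma rnorm_scalar0 : rnorm (0 : K^o) = 0.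
Proof. exact: (rnorm0 (K^o : normedModType K)). Qed.

Lemma rnormN (V : normedModType K) (x : V) : rnorm (- x) = rnorm x.
Proof. by rewrite /rnorm normrN. Qed.

Lemma rnormM (k l : K) :
  rnorm (k * l : K^o) = rnorm (k : K^o) * rnorm (l : K^o).
Proof. exact: (@rnormZ R s K^o k l). Qed.

Lemma rnormV (k : K) : rnorm (k^-1 : K^o) = (rnorm (k : K^o))^-1.
Proof.
have [->|k0] := eqVneq k 0.
  by rewrite invr0 rnorm_scalar0 invr0.
have k1 : rnorm (k : K^o) != 0.
  by apply: contra_neq k0 => /(@rnorm_eq0 R s K^o).
by apply: (mulfI k1); rewrite -rnormM !mulfV// rnorm1.
Qed.

Lemma rdistC (V : normedModType K) (x y : V) : rnorm (x - y) = rnorm (y - x).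
Proof. by rewrite -opprB rnormN. Qed.

Lemma ler_rnormB (V : normedModType K) (x y : V) :
  rnorm (x - y) <= rnorm x + rnorm y.
Proof. by rewrite -(rnormN y) ler_rnormD. Qed.

Lemma ler_rdist (V : normedModType K) (x y z : V) :
  rnorm (x - z) <= rnorm (x - y) + rnorm (y - z).
Proof. by rewrite -[x - z](subrKA y) ler_rnormD. Qed.

Lemma ler_rnorm_sub (V : normedModType K) (x y : V) :
  rnorm x <= rnorm y + rnorm (x - y).
Proof. by rewrite -{1}(subrK y x) addrC ler_rnormD. Qed.

Lemma rnorm_gt0 (V : normedModType K) (x : V) : (0 < rnorm x) = (x != 0).
Proof.
rewrite lt_def rnorm_ge0 andbT; apply/negP/idP => [h|/negP h /eqP/rnorm_eq0 x0].
  by apply/eqP => x0; apply: h; rewrite x0 rnorm0.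
by apply: h; apply/eqP.
Qed.

Lemma ler_rnorm_sum (V : normedModType K) I (r : seq I) (f : I -> V) :
  rnorm (\sum_(i <- r) f i) <= \sum_(i <- r) rnorm (f i).
Proof.
elim/big_rec2 : _ => [|i y x _ h]; first by rewrite rnorm0.
by apply: le_trans (ler_rnormD _ _) _; rewrite lerD2l.
Qed.

(** Convergence tested with real radii: the order of a complex scalar field
    only compares numbers that differ by a real. *)
Lemma cvg_rnormP (V : normedModType K) T (F : set_system T) (FF : Filter F)
    (f : T -> V) (l : V) :
  f @ F --> l <->
  forall e : R, 0 < e -> \forall t \near F, rnorm (f t - l) < e.
Proof.
split=> [/cvgrPdist_lt h e e0|h].
  have := h (of_real s e); rewrite -(of_real0 R s) ltr_of_real => /(_ e0).
  by apply: filterS => t; rewrite -of_real_rnorm ltr_of_real rdistC.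
apply/cvgrPdist_lt => k k0; have := h _ (of_real_gt0 k0).
apply: filterS => t; rewrite -[X in _ -> _ < X](real_partK (ltW k0)).
by rewrite -of_real_rnorm ltr_of_real rdistC.
Qed.

Lemma cvgn_rnormP (V : normedModType K) (f : nat -> V) (l : V) :
  f @ \oo --> l <->
  forall e : R, 0 < e -> exists N, forall n, (N <= n)%N -> rnorm (f n - l) < e.
Proof.
split=> [/cvg_rnormP h e /h[N _ hN]|h]; first by exists N => n /hN.
by apply/cvg_rnormP => e /h[N hN]; exists N => // n /= /hN.
Qed.

Lemma cauchy_rnormP (V : normedModType K) (f : nat -> V) :
  cauchy (f @ \oo) <->
  forall e : R, 0 < e -> exists N, forall m n, (N <= m)%N -> (N <= n)%N ->
    rnorm (f m - f n) < e.
Proof.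
have FF : ProperFilter (f @ \oo) by exact: fmap_proper_filter.
split=> [/cauchyP h e e0|h].
  have := h (of_real s (e / 2)); rewrite -(of_real0 R s) ltr_of_real.
  rewrite divr_gt0// => /(_ isT)[x [N _ hN]]; exists N => m n Nm Nn.
  have := hN m Nm; have := hN n Nn; rewrite /= -!ball_normE /=.
  rewrite -!of_real_rnorm !ltr_of_real => h1 h2.
  apply: le_lt_trans (ler_rdist _ x _) _.
  by rewrite (splitr e) rdistC ltrD.
apply/cauchyP => k k0; have [N hN] := h _ (of_real_gt0 k0).
exists (f N); exists N => // n /= Nn; rewrite -ball_normE /=.
by rewrite -(real_partK (ltW k0)) -of_real_rnorm ltr_of_real hN.
Qed.

Lemma phase (k : K) :
  exists2 t : K, rnorm (t : K^o) <= 1 & t * k = of_real s (rnorm (k : K^o)).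
Proof.
have [->|k0] := eqVneq k 0.
  exists 0; first by rewrite rnorm_scalar0.
  by rewrite mulr0 rnorm_scalar0 of_real0.
exists (`|k| / k).
  rewrite rnormM rnormV.
  have -> : rnorm (`|k| : K^o) = rnorm (k : K^o) by rewrite /rnorm normr_id.
  by rewrite mulfV// (gt_eqF _) ?rnorm_gt0.
by rewrite mulfVK// of_real_rnorm.
Qed.

End RealNormComplements.

(** * Limits along ultrafilters *)

Section UltraLimits.
Variables (R : realType) (T : choiceType) (G : set_system T).
Hypothesis GU : UltraFilter G.

(** The compact segment provides a cluster point, and an ultrafilter converges
    to each of its cluster points. *)
Lemma ultra_cvg_real (f : T -> R) (M : R) :
  (\forall t \near G, `|f t| <= M) ->
  exists l : R, forall e, 0 < e -> \forall t \near G, `|f t - l| < e.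
Proof.
move=> fM; have := @segment_compact R (- M) M.
move=> /(_ (f @ G) _)[].
- by apply: filterS fM => t; rewrite /= in_itv /= -ler_norml.
move=> l [_ cl]; exists l => e e0.
have [//|Gn] := in_ultra_setVsetC [set t | `|f t - l| < e] GU.
have fGn : (f @ G) (f @` ~` [set t | `|f t - l| < e]).
  by apply: (@filterS _ G _ _ _ _ Gn) => t nt /=; exists t.
have [x [[t nt <-] lx]] := cl _ _ fGn (nbhsx_ballx l e e0).
by exfalso; apply: nt => /=; rewrite distrC.
Qed.

Lemma ultra_cvg_scalar (s : scalars) (f : T -> (scalar_field R s)^o) (M : R) :
  (\forall t \near G, rnorm (f t) <= M) ->
  exists l : scalar_field R s,
    forall e : R, 0 < e -> \forall t \near G, rnorm (f t - l) < e.
Proof.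
case: s f => /= f fM; first exact: (ultra_cvg_real fM).
have [a ha] : exists l : R, forall e, 0 < e ->
    \forall t \near G, `|complex.Re (f t) - l| < e.
  apply: (@ultra_cvg_real _ M); apply: filterS fM => t; apply: le_trans.
  case: (f t) => x y.
  by rewrite /rnorm /= -sqrtr_sqr ler_wsqrtr// lerDl sqr_ge0.
have [b hb] : exists l : R, forall e, 0 < e ->
    \forall t \near G, `|complex.Im (f t) - l| < e.
  apply: (@ultra_cvg_real _ M); apply: filterS fM => t; apply: le_trans.
  case: (f t) => x y.
  by rewrite /rnorm /= -sqrtr_sqr ler_wsqrtr// lerDr sqr_ge0.
exists (a +i* b)%C => e e0; have e20 : 0 < e / 2 by rewrite divr_gt0.
apply: filterS2 (ha _ e20) (hb _ e20) => t xa yb.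
rewrite (splitr e); apply: le_lt_trans (ltrD xa yb).
case: (f t) => x y /=; rewrite -[leRHS]ger0_norm ?addr_ge0//.
rewrite -[leRHS]sqrtr_sqr ler_wsqrtr// [leRHS]sqrrD !real_normK ?num_real//.
by rewrite lerD2r lerDl mulrn_wge0// mulr_ge0.
Qed.

End UltraLimits.

(** * Bounded functionals *)

Section BoundedFunctionals.
Variables (R : realType) (s : scalars).
Local Notation K := (scalar_field R s).

Lemma continuous_rnorm_le (V W : normedModType K) (f : V -> W) (M : R) :
  linear f -> (forall x, rnorm (f x) <= M * rnorm x) -> continuous f.
Proof.
move=> lf fM x; apply/cvg_rnormP => e e0.
have M0 : 0 < `|M| + 1 by rewrite ltr_wpDl.
have : x @[x --> x] --> x by exact: cvg_id.
move=> /cvg_rnormP/(_ (e / (`|M| + 1))).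
rewrite divr_gt0// => /(_ isT); apply: filterS => y.
have -> : f y - f x = f (y - x).
  by have := lf (-1) x y; rewrite !scaleN1r addrC => <-; rewrite addrC.
rewrite ltr_pdivlMr// mulrC => h; apply: le_lt_trans (fM _) (le_lt_trans _ h).
by rewrite ler_wpM2r ?rnorm_ge0// (le_trans (ler_norm M))// lerDl.
Qed.

Lemma dual_predP (E : normedModType K) (f : E -> K^o) (M : R) :
  linear f -> (forall x, rnorm (f x) <= M * rnorm x) -> dual_pred f.
Proof.
by move=> lf fM; apply/asboolP; split=> //; exact: continuous_rnorm_le fM.
Qed.

Lemma ler_dual (E : normedModType K) (f : dual E) x :
  rnorm (f x) <= rnorm f * rnorm x.
Proof.
have [->|x0] := eqVneq x 0.
  by rewrite linear0 rnorm_scalar0 (rnorm0 E) mulr0.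
have nx : 0 < rnorm x by rewrite rnorm_gt0.
rewrite -ler_pdivrMr// mulrC.
have e : rnorm (of_real s (rnorm x)^-1 : K^o) = (rnorm x)^-1.
  by rewrite rnorm_of_real gtr0_norm// invr_gt0.
rewrite -{1}e -rnormZ -linearZ rnorm_dualE; apply: dual_rnorm_ub.
by rewrite ball_rnorm rnormZ e mulVf// gt_eqF.
Qed.

Lemma dual_le (E : normedModType K) (f : dual E) (M : R) : 0 <= M ->
  (forall x, rnorm (f x) <= M * rnorm x) -> rnorm f <= M.
Proof.
move=> M0 fM; rewrite rnorm_dualE; apply: dual_rnorm_le => x.
rewrite ball_rnorm => x1; apply: le_trans (fM x) _.
by rewrite -[leRHS]mulr1 ler_wpM2l.
Qed.

Lemma dual_attain (E : normedModType K) (f : dual E) (c : R) :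
  c < rnorm f -> exists2 x : E, rnorm x <= 1 & c < rnorm (f x).
Proof.
rewrite rnorm_dualE => /(sup_gt (dual_rnorm_has_sup f).1)[_ [x x1 <-] cx].
by exists x => //; rewrite -ball_rnorm.
Qed.

Lemma dual_sumE (E : normedModType K) I (r : seq I) (f : I -> dual E) x :
  (\sum_(i <- r) f i) x = \sum_(i <- r) f i x.
Proof.
by elim: r => [|i r IH]; rewrite ?big_nil// !big_cons dualDE IH.
Qed.

(** The moduli on the left are absorbed in the coefficients [c], so that only
    one value of the functional remains. *)
Lemma sum_rnorm_functional (V : normedModType K) (psi : dual V) I
    (y : I -> V) (t : seq I) (B : R) :
  (forall c : I -> K, (forall j, rnorm (c j : K^o) <= 1) ->
    rnorm (\sum_(j <- t) c j *: y j) <= B) ->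
  \sum_(j <- t) rnorm (psi (y j)) <= rnorm psi * B.
Proof.
move=> yB; have /choice[c hc] : forall j, exists c : K, rnorm (c : K^o) <= 1 /\
    c * psi (y j) = of_real s (rnorm (psi (y j))).
  by move=> j; have [c c1 cE] := phase (psi (y j)); exists c.
have E : psi (\sum_(j <- t) c j *: y j) =
    of_real s (\sum_(j <- t) rnorm (psi (y j))).
  rewrite linear_sum (big_morph _ (@of_realD R s) (@of_real0 R s)).
  by apply: eq_bigr => j _; rewrite linearZ /= -(hc j).2.
have := ler_dual psi (\sum_(j <- t) c j *: y j).
rewrite E rnorm_of_real ger0_norm ?sumr_ge0// => [h|j _]; last exact: rnorm_ge0.
apply: le_trans h _; rewrite ler_wpM2l ?rnorm_ge0 ?yB// => j.
exact: (hc j).1.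
Qed.

Section Evaluation.
Variables (E : normedModType K) (x : E).

Lemma dual_eval_linear : linear (fun f : dual E => f x : K^o).
Proof. by []. Qed.

Lemma dual_eval_le (f : dual E) : rnorm (f x) <= rnorm x * rnorm f.
Proof. by rewrite mulrC ler_dual. Qed.

Definition dual_eval : dual (dual E) :=
  Dual (dual_predP dual_eval_linear dual_eval_le).

Lemma dual_evalE f : dual_eval f = f x.
Proof. by []. Qed.

Lemma rnorm_dual_eval : rnorm dual_eval <= rnorm x.
Proof. by apply: dual_le; [exact: rnorm_ge0|exact: dual_eval_le]. Qed.

End Evaluation.

Section Composition.
Variables (V W : normedModType K) (L : {linear V -> W}) (M : R).
Hypothesis LM : forall x, rnorm (L x) <= M * rnorm x.

Lemma dual_comp_linear (f : dual W) : linear (f \o L : V -> K^o).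
Proof. by move=> k x y /=; rewrite !linearP. Qed.

Lemma dual_comp_le (f : dual W) x : rnorm ((f \o L) x) <= rnorm f * M * rnorm x.
Proof.
apply: le_trans (ler_dual _ _) _.
by rewrite -mulrA ler_wpM2l ?rnorm_ge0.
Qed.

Definition dual_comp (f : dual W) : dual V :=
  Dual (dual_predP (@dual_comp_linear f) (@dual_comp_le f)).

End Composition.

End BoundedFunctionals.

(** * Generalised limits and completeness *)

(** Limits along a free ultrafilter exist for all bounded scalar sequences and
    depend linearly on them; they replace weak-star cluster points. *)
Definition free_ultrafilter : set_system nat :=
  projT1 (cid (ultraFilterLemma (eventually_filter : ProperFilter \oo))).

Lemma free_ultrafilterP : UltraFilter free_ultrafilter.
Proof. by rewrite /free_ultrafilter; case: cid => G []. Qed.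
#[global] Existing Instance free_ultrafilterP.

Local Notation omega := free_ultrafilter.

Lemma free_ultrafilter_oo : \oo `<=` omega.
Proof. by rewrite /free_ultrafilter; case: cid => G []. Qed.

Lemma near_free (P : nat -> Prop) :
  (\forall n \near \oo, P n) -> \forall n \near omega, P n.
Proof. exact: free_ultrafilter_oo. Qed.

Section GeneralisedLimit.
Variables (R : realType) (s : scalars).
Local Notation K := (scalar_field R s).

Definition ulim (a : nat -> K^o) : K^o :=
  xget 0 [set l : K^o | forall e : R, 0 < e ->
    \forall n \near omega, rnorm (a n - l) < e].

Lemma ulimP (a : nat -> K^o) (M : R) : (forall n, rnorm (a n) <= M) ->
  forall e : R, 0 < e -> \forall n \near omega, rnorm (a n - ulim a) < e.
Proof.
move=> aM; have [|l hl] := @ultra_cvg_scalar R nat omega _ s a M.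
  by apply: nearW => n; exact: aM.
exact: (@xgetPex _ 0 [set l : K^o | forall e : R, 0 < e ->
  \forall n \near omega, rnorm (a n - l) < e] (ex_intro _ l hl)).
Qed.

Lemma ulim_dist (a : nat -> K^o) (M : R) (w : K^o) (c : R) :
  (forall n, rnorm (a n) <= M) ->
  (\forall n \near omega, rnorm (a n - w) <= c) -> rnorm (ulim a - w) <= c.
Proof.
move=> aM ac; apply/ler_addgt0Pr => e e0.
have [n [h1 h2]] := @filter_ex _ omega _ _ (filterI (ulimP aM e0) ac).
by apply: le_trans (ler_rdist _ (a n) _) _; rewrite addrC lerD// rdistC ltW.
Qed.

Lemma rnorm_ulim (a : nat -> K^o) (M : R) :
  (forall n, rnorm (a n) <= M) -> rnorm (ulim a) <= M.
Proof.
move=> aM; rewrite -[ulim a]subr0; apply: (ulim_dist aM).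
by apply: nearW => n; rewrite subr0; exact: aM.
Qed.

Lemma eq_of_rnorm (V : normedModType K) (x y : V) :
  (forall e : R, 0 < e -> rnorm (x - y) <= e) -> x = y.
Proof.
move=> h; apply/subr0_eq/rnorm_eq0/eqP; rewrite eq_le rnorm_ge0 andbT.
by apply/ler_addgt0Pr => e /h; rewrite add0r.
Qed.

Lemma ulim_linear (k : K) (a b : nat -> K^o) (Ma Mb : R) :
  (forall n, rnorm (a n) <= Ma) -> (forall n, rnorm (b n) <= Mb) ->
  ulim (fun n => k *: a n + b n) = k *: ulim a + ulim b.
Proof.
move=> aM bM; have k1 : 0 < rnorm (k : K^o) + 1 by rewrite ltr_wpDl ?rnorm_ge0.
apply: eq_of_rnorm => e e0.
apply: (@ulim_dist _ (rnorm (k : K^o) * Ma + Mb)).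
  move=> n; apply: le_trans (ler_rnormD _ _) _.
  by rewrite rnormZ lerD// ler_wpM2l ?rnorm_ge0.
have h1 := @ulimP a Ma aM (e / 2 / (rnorm (k : K^o) + 1)).
have h2 := @ulimP b Mb bM (e / 2).
have e20 : 0 < e / 2 by rewrite divr_gt0.
apply: filterS2 (h1 (divr_gt0 e20 k1)) (h2 e20) => n an bn.
rewrite opprD addrACA -scalerBr; apply: le_trans (ler_rnormD _ _) _.
rewrite (splitr e) lerD// ?(ltW bn)// rnormZ.
apply: (@le_trans _ _ ((rnorm (k : K^o) + 1) * rnorm (a n - ulim a))).
  by rewrite ler_wpM2r ?rnorm_ge0// lerDl.
by rewrite mulrC -ler_pdivlMr// ltW.
Qed.

End GeneralisedLimit.

Section HasLimits.
Variables (R : realType) (s : scalars).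
Local Notation K := (scalar_field R s).

(** A common feature of dual spaces and of ell1: a bounded sequence has a
    generalised limit, and closed balls are stable under such limits.  It
    gives completeness, and convergence of series, at one stroke. *)
Definition has_limits (V : normedModType K) :=
  forall (v : nat -> V) (M : R), (forall i, rnorm (v i) <= M) ->
    exists l : V, forall w c,
      (\forall i \near \oo, rnorm (v i - w) <= c) -> rnorm (l - w) <= c.

(** For a Cauchy sequence the generalised limit is the limit, with the same
    rate. *)
Lemma has_limits_cvg (V : normedModType K) (v : nat -> V) (d : nat -> R) :
  has_limits V -> (forall i j, (i <= j)%N -> rnorm (v j - v i) <= d i) ->
  exists l : V, forall i, rnorm (l - v i) <= d i.
Proof.
move=> hV vd; have [|l hl] := hV v (rnorm (v 0%N) + d 0%N).
  by move=> i; rewrite (le_trans (ler_rnorm_sub _ (v 0%N)))// lerD2l vd.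
by exists l => i; apply: hl; exists i => // j /= /vd.
Qed.

Lemma has_limits_complete (V : normedModType K) : has_limits V ->
  forall F : set_system V, ProperFilter F -> cauchy F -> cvg F.
Proof.
move=> hV F FF /cauchyP Fc.
have pos i : 0 < i.+1%:R^-1 :> R by rewrite invr_gt0.
have /choice[v vF] : forall i, exists x : V,
    F [set y | rnorm (y - x) < i.+1%:R^-1].
  move=> i; have := Fc (of_real s i.+1%:R^-1).
  rewrite -(of_real0 R s) ltr_of_real => /(_ (pos i))[x Fx]; exists x.
  apply: filterS Fx => y; rewrite -ball_normE /=.
  by rewrite -of_real_rnorm ltr_of_real rdistC.
have vd i j : (i <= j)%N -> rnorm (v j - v i) <= 2 * i.+1%:R^-1.
  move=> ij; have [y [yi yj]] := filter_ex (filterI (vF i) (vF j)).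
  apply: le_trans (ler_rdist _ y _) _; rewrite mulr2n mulrDl mul1r lerD//.
    rewrite rdistC (le_trans (ltW yj))// lef_pV2 ?posrE//.
    by rewrite ler_nat.
  exact: ltW.
have [l hl] := has_limits_cvg hV vd.
apply/cvg_ex; exists l; apply/cvgrPdist_lt => k k0.
have rk0 := of_real_gt0 k0.
have [i hi] : exists i : nat, 3 * i.+1%:R^-1 < real_part k.
  exists (Num.trunc (3 / real_part k)).
  rewrite ltr_pdivrMr// mulrC -ltr_pdivrMr//.
  exact: truncnS_gt.
apply: filterS (vF i) => y /= yi.
rewrite -(real_partK (ltW k0)) -of_real_rnorm ltr_of_real.
apply: le_lt_trans (ler_rdist _ (v i) _) _; apply: le_lt_trans hi.
have -> : 3 * i.+1%:R^-1 = 2 * i.+1%:R^-1 + i.+1%:R^-1 :> R by ring.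
by rewrite lerD// ?hl// rdistC ltW.
Qed.

Lemma scalar_has_limits : has_limits K^o.
Proof.
move=> v M vM; exists (ulim v) => w c h.
exact: ulim_dist vM (near_free h).
Qed.

(** The generalised limit is taken pointwise. *)
Lemma dual_has_limits (E : normedModType K) : has_limits (dual E).
Proof.
move=> v M vM.
have vxM i x : rnorm (v i x) <= M * rnorm x.
  by apply: le_trans (ler_dual _ _) _; rewrite ler_wpM2r ?rnorm_ge0.
pose l x := ulim (fun i => v i x).
have ll : linear l.
  move=> k x y; rewrite /l.
  rewrite -(@ulim_linear _ _ _ _ _ (M * rnorm x) (M * rnorm y))//.
  by congr ulim; apply/funext => i; rewrite linearP.
have lM x : rnorm (l x) <= M * rnorm x by exact: rnorm_ulim.
exists (Dual (dual_predP ll lM)) => w c h; apply: dual_le => [|x].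
  have [i hi] := @filter_ex _ \oo _ _ h.
  exact: le_trans (rnorm_ge0 _) hi.
apply: (@ulim_dist _ _ (fun i => v i x) (M * rnorm x)) => //.
apply: near_free; apply: filterS h => i hi.
apply: le_trans (ler_dual (v i - w) x) _.
by rewrite ler_wpM2r ?rnorm_ge0.
Qed.

HB.instance Definition _ (E : normedModType K) :=
  Uniform_isComplete.Build (dual E) (has_limits_complete (@dual_has_limits E)).

(** Invertibility of [1 - N] when [N] has norm at most 1/2: the Neumann series
    is summed by the iteration [x := b + N x]. *)
Lemma neumann (V : normedModType K) (N : V -> V) (b : V) :
  has_limits V -> linear N -> (forall x, rnorm (N x) <= 2^-1 * rnorm x) ->
  exists2 x, x - N x = b & rnorm x <= 2 * rnorm b.
Proof.
move=> hV lN Nh.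
have NB x y : N x - N y = N (x - y).
  by have := lN (-1) y x; rewrite !scaleN1r addrC => <-; rewrite addrC.
pose x i := iter i (fun z => b + N z) 0.
have xb i : rnorm (x i) <= 2 * rnorm b.
  elim: i => [|i IH]; first by rewrite /= rnorm0 mulr_ge0 ?rnorm_ge0.
  apply: le_trans (ler_rnormD b (N (x i))) _.
  have := Nh (x i); lra.
have xd i j : (i <= j)%N -> rnorm (x j - x i) <= 2^-1 ^+ i * (2 * rnorm b).
  elim: i j => [|i IH] [|j]//.
  - by rewrite subr0 expr0 mul1r xb.
  - by rewrite subr0 expr0 mul1r xb.
  rewrite ltnS => /IH h.
  rewrite -[x j.+1]/(b + N (x j)) -[x i.+1]/(b + N (x i)).
  rewrite opprD addrACA subrr add0r NB exprS -mulrA.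
  by apply: le_trans (Nh _) _; rewrite ler_wpM2l.
have [l hl] := has_limits_cvg hV xd; exists l; last first.
  by have := hl 0%N; rewrite subr0 expr0 mul1r.
apply: eq_of_rnorm => e e0.
pose B := 2 * rnorm b + 1.
have B0 : 0 < B by rewrite ltr_wpDl// mulr_ge0 ?rnorm_ge0.
have [i hi] : exists i, 2^-1 ^+ i * B <= e.
  have := @cvg_expr R 2^-1; rewrite gtr0_norm// invf_lt1// ltr1n => /(_ isT).
  move=> /cvgrPdist_lt/(_ (e / B)).
  rewrite divr_gt0// => /(_ isT)[i _ /(_ i (leqnn i))].
  rewrite /= sub0r normrN ger0_norm ?exprn_ge0// => h.
  by exists i; rewrite -ler_pdivlMr// ltW.
have -> : l - N l - b = (l - x i.+1) + N (x i - l).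
  rewrite -NB -[x i.+1]/(b + N (x i)) opprD (addrA l (- b)).
  by rewrite subrKA addrAC.
apply: le_trans (ler_rnormD _ _) _; apply: le_trans hi.
have h1 := hl i.+1; have h2 := hl i.
have h3 := Nh (x i - l); rewrite (rdistC (x i)) in h3.
have e1 : 2^-1 ^+ i * (2 * rnorm b) <= 2^-1 ^+ i * B.
  by rewrite ler_wpM2l ?exprn_ge0// lerDl.
by rewrite exprS in h1; lra.
Qed.

End HasLimits.

(** * The space of summable sequences *)

Definition linear_map (K : numFieldType) (V W : lmodType K) (f : V -> W)
    (lf : linear f) : {linear V -> W} :=
  HB.pack f (GRing.isLinear.Build K V W *:%R f lf).

Section Ell1Theory.
Variables (R : realType) (s : scalars).
Local Notation K := (scalar_field R s).
Local Notation l1 := (ell1 R s).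

Lemma ell1_psum_nd (a : nat -> K^o) :
  nondecreasing_seq (series (fun n => rnorm (a n))).
Proof.
apply/nondecreasing_seqP => m.
by rewrite /series/= big_nat_recr//= lerDl rnorm_ge0.
Qed.

Lemma ell1_psum_le (a : l1) n : \sum_(0 <= i < n) rnorm (a i) <= rnorm a.
Proof.
rewrite rnorm_ell1E.
exact: (nondecreasing_cvgn_le (@ell1_psum_nd a) (@ell1_cvg _ _ a) n).
Qed.

Lemma ell1_coord_le (a : l1) n : rnorm (a n) <= rnorm a.
Proof.
apply: le_trans (ell1_psum_le a n.+1); rewrite big_nat_recr//= lerDr.
by apply: sumr_ge0 => i _; exact: rnorm_ge0.
Qed.

Lemma ell1_predP (a : nat -> K^o) (M : R) :
  (forall n, \sum_(0 <= i < n) rnorm (a i) <= M) -> ell1_pred a.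
Proof.
move=> aM; apply/asboolP; apply: nondecreasing_is_cvgn.
  exact: ell1_psum_nd.
by exists M => _ [n _ <-]; exact: aM.
Qed.

Lemma ell1_le (a : l1) (M : R) :
  (forall n, \sum_(0 <= i < n) rnorm (a i) <= M) -> rnorm a <= M.
Proof.
move=> aM; rewrite rnorm_ell1E; apply: limr_le; first exact: ell1_cvg.
by apply: nearW => n; exact: aM.
Qed.

Lemma ell1_eq (a b : l1) : (forall n, a n = b n) -> a = b.
Proof. by move=> ab; apply/val_inj/funext. Qed.

Lemma ell1DE (a b : l1) n : (a + b) n = a n + b n. Proof. by []. Qed.
Lemma ell1BE (a b : l1) n : (a - b) n = a n - b n. Proof. by []. Qed.
Lemma ell1ZE k (a : l1) n : (k *: a) n = k *: a n. Proof. by []. Qed.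

Lemma ell1_sumE I (r : seq I) (f : I -> l1) n :
  (\sum_(i <- r) f i) n = \sum_(i <- r) f i n.
Proof.
by elim: r => [|i r IH]; rewrite ?big_nil// !big_cons ell1DE IH.
Qed.

Lemma ell1_delta_sum (n m : nat) :
  \sum_(0 <= i < m) rnorm ((i == n)%:R : K^o) <= 1.
Proof.
elim: m => [|m IH]; first by rewrite big_nil.
rewrite big_nat_recr//=; have [mn|_] := eqVneq m n; last first.
  by rewrite rnorm_scalar0 addr0.
rewrite big_nat_cond big1 ?add0r ?rnorm1// => i /andP[/andP[_ im] _].
by rewrite -mn (ltn_eqF im) rnorm_scalar0.
Qed.

Definition ell1_delta n : l1 := Ell1 (ell1_predP (ell1_delta_sum n)).

Lemma ell1_deltaE n i : ell1_delta n i = (i == n)%:R. Proof. by []. Qed.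

Lemma rnorm_ell1_delta n : rnorm (ell1_delta n) <= 1.
Proof. by apply: ell1_le => m; exact: ell1_delta_sum. Qed.

Definition ell1_trunc (a : l1) N : l1 := \sum_(0 <= n < N) a n *: ell1_delta n.

Lemma ell1_truncE (a : l1) N i :
  ell1_trunc a N i = if (i < N)%N then a i else 0.
Proof.
rewrite /ell1_trunc ell1_sumE; elim: N => [|N IH]; first by rewrite big_nil.
rewrite big_nat_recr// IH ell1ZE ell1_deltaE ltnS /=.
have [iN|Ni|->] := ltngtP i N; rewrite ?scaler0 ?addr0//.
by rewrite add0r /GRing.scale /= mulr1.
Qed.

Lemma ell1_trunc_dist (a : l1) N :
  rnorm (a - ell1_trunc a N) <= rnorm a - \sum_(0 <= i < N) rnorm (a i).
Proof.
have tE i : rnorm ((a - ell1_trunc a N) i) =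
    if (i < N)%N then 0 else rnorm (a i).
  rewrite ell1BE ell1_truncE; case: ifP; rewrite ?subr0// subrr.
  by rewrite rnorm_scalar0.
apply: ell1_le => n; under eq_bigr do rewrite tE.
rewrite lerBrDr; apply: le_trans (ell1_psum_le a (N + n)).
rewrite [leRHS](@big_cat_nat _ _ _ N)//= ?leq_addr// [leLHS]addrC lerD2l.
have [nN|Nn] := leqP n N.
  rewrite big_nat_cond big1 ?sumr_ge0// => [i _|i /andP[/andP[_ iN] _]].
    exact: rnorm_ge0.
  by rewrite (leq_trans iN nN).
rewrite (@big_cat_nat _ _ _ N)//= 1?ltnW// [X in X + _]big_nat_cond.
rewrite big1 ?add0r => [|i /andP[/andP[_ iN] _]]; last by rewrite iN.
rewrite [leRHS](@big_cat_nat _ _ _ n)//= ?leq_addl//; last exact: ltnW.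
rewrite -[leLHS]addr0 lerD ?sumr_ge0// => [|i _]; last exact: rnorm_ge0.
rewrite le_eqVlt; apply/orP; left; apply/eqP.
apply: eq_big_nat => i /andP[Ni _].
by rewrite ltnNge Ni.
Qed.

Lemma ell1_trunc_cvg (a : l1) (e : R) : 0 < e ->
  exists N, rnorm (a - ell1_trunc a N) < e.
Proof.
move=> e0; have /cvgrPdist_lt/(_ _ e0)[N _ /(_ N (leqnn N)) h] :=
  @ell1_cvg _ _ a.
exists N; apply: le_lt_trans (ell1_trunc_dist _ _) _.
by rewrite rnorm_ell1E (le_lt_trans (ler_norm _) h).
Qed.

(** The unit vectors span a dense subspace. *)
Lemma ell1_ext (V : normedModType K) (L L' : {linear l1 -> V}) (M M' : R) :
  (forall a, rnorm (L a) <= M * rnorm a) ->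
  (forall a, rnorm (L' a) <= M' * rnorm a) ->
  (forall n, L (ell1_delta n) = L' (ell1_delta n)) -> L =1 L'.
Proof.
move=> LM LM' LL a; apply: eq_of_rnorm => e e0.
have M0 : 0 < `|M| + `|M'| + 1 by rewrite ltr_wpDl// addr_ge0.
have [N hN] := @ell1_trunc_cvg a _ (divr_gt0 e0 M0).
have LLt : L (ell1_trunc a N) = L' (ell1_trunc a N).
  rewrite /ell1_trunc !linear_sum; apply: eq_bigr => i _.
  by rewrite !linearZ /= LL.
have -> : L a - L' a = L (a - ell1_trunc a N) - L' (a - ell1_trunc a N).
  by rewrite (linearB L) (linearB L') /= LLt opprB addrA subrK.
apply: le_trans (ler_rnormB _ _) _.
apply: le_trans (lerD (LM _) (LM' _)) _; rewrite -mulrDl.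
apply: (@le_trans _ _ ((`|M| + `|M'| + 1) * rnorm (a - ell1_trunc a N))).
  by rewrite ler_wpM2r ?rnorm_ge0// ler_wpDr// lerD// ler_norm.
by rewrite mulrC -ler_pdivlMr// ltW.
Qed.

Section Synthesis.
Variables (V : normedModType K) (w : nat -> V) (M : R).
Hypotheses (hV : has_limits V) (wM : forall n, rnorm (w n) <= M).

Let psum (a : l1) N := \sum_(0 <= n < N) a n *: w n.

Let M0 : 0 <= M. Proof. exact: le_trans (rnorm_ge0 _) (wM 0%N). Qed.

Let psum_dist (a : l1) i j : (i <= j)%N ->
  rnorm (psum a j - psum a i) <= M * (rnorm a - \sum_(0 <= n < i) rnorm (a n)).
Proof.
move=> ij; rewrite /psum (@big_cat_nat _ _ _ i)//= addrAC subrr add0r.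
apply: le_trans (ler_rnorm_sum _ _) _.
apply: (@le_trans _ _ (M * \sum_(i <= n < j) rnorm (a n))).
  rewrite mulr_sumr ler_sum// => n _.
  by rewrite rnormZ mulrC ler_wpM2r ?rnorm_ge0.
rewrite ler_wpM2l// lerBrDr addrC -(@big_cat_nat _ _ _ i)//=.
exact: ell1_psum_le.
Qed.

Let tail_small (a : l1) (e : R) : 0 < e -> exists N, forall i, (N <= i)%N ->
  M * (rnorm a - \sum_(0 <= n < i) rnorm (a n)) < e.
Proof.
move=> e0; have M1 : 0 < M + 1 by rewrite ltr_wpDl.
have /cvgrPdist_lt/(_ _ (divr_gt0 e0 M1))[N _ h] := @ell1_cvg _ _ a.
exists N => i Ni; have := h i Ni; rewrite -rnorm_ell1E /series /= => h'.
apply: (@le_lt_trans _ _ ((M + 1) * (rnorm a - \sum_(0 <= n < i) rnorm (a n)))).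
  by rewrite ler_wpM2r ?lerDl// subr_ge0 ell1_psum_le.
by rewrite mulrC -ltr_pdivlMr// (le_lt_trans (ler_norm _) h').
Qed.

(** The freeness of ell1: a bounded sequence [w] defines the operator sending
    [a] to the sum of the [a n *: w n]. *)
Lemma ell1_synthesis : exists L : {linear l1 -> V},
  (forall n, L (ell1_delta n) = w n) /\
  forall a, rnorm (L a) <= M * rnorm a.
Proof.
have /choice[L hL] : forall a, exists l : V, forall i,
    rnorm (l - psum a i) <= M * (rnorm a - \sum_(0 <= n < i) rnorm (a n)).
  by move=> a; exact: (has_limits_cvg hV (@psum_dist a)).
have lL : linear L.
  move=> k a b; apply: eq_of_rnorm => e e0.
  have e30 : 0 < e / 3 by rewrite divr_gt0.
  have k1 : 0 < rnorm (k : K^o) + 1 by rewrite ltr_wpDl ?rnorm_ge0.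
  have [N1 h1] := tail_small (k *: a + b) e30.
  have [N2 h2] := tail_small a (divr_gt0 e30 k1).
  have [N3 h3] := tail_small b e30.
  pose N := maxn N1 (maxn N2 N3).
  have {}h1 := le_lt_trans (hL (k *: a + b) N) (h1 N (leq_maxl _ _)).
  have {}h2 := le_lt_trans (hL a N) (h2 N _).
  have {}h3 := le_lt_trans (hL b N) (h3 N _).
  have {}h2 := h2 (leq_trans (leq_maxl _ _) (leq_maxr _ _)).
  have {}h3 := h3 (leq_trans (leq_maxr _ _) (leq_maxr _ _)).
  have pE : psum (k *: a + b) N = k *: psum a N + psum b N.
    rewrite /psum scaler_sumr -big_split /=; apply: eq_bigr => i _.
    change ((k * a i + b i) *: w i = k *: (a i *: w i) + b i *: w i).
    by rewrite scalerDl scalerA.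
  have -> : L (k *: a + b) - (k *: L a + L b) =
      (L (k *: a + b) - psum (k *: a + b) N)
      - (k *: (L a - psum a N) + (L b - psum b N)).
    rewrite pE scalerBr [X in _ = _ - X]addrACA -opprD opprB.
    by rewrite subrKA.
  apply: le_trans (ler_rnormB _ _) _.
  have h4 := ler_rnormD (k *: (L a - psum a N)) (L b - psum b N).
  rewrite rnormZ in h4.
  have h5 : rnorm (k : K^o) * rnorm (L a - psum a N) <= e / 3.
    apply: (@le_trans _ _ ((rnorm (k : K^o) + 1) * rnorm (L a - psum a N))).
      by rewrite ler_wpM2r ?rnorm_ge0// lerDl.
    by rewrite mulrC -ler_pdivlMr// ltW.
  lra.
exists (linear_map lL); split => [n|a] /=; last first.
  by have := hL a 0%N; rewrite /psum !big_nil !subr0.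
apply: eq_of_rnorm => e e0.
have [N hN] := tail_small (ell1_delta n) e0.
have := hL (ell1_delta n) (maxn N n.+1).
have -> : psum (ell1_delta n) (maxn N n.+1) = w n.
  rewrite /psum (big_rem n) /=; last by rewrite mem_index_iota leq_maxr.
  rewrite eqxx scale1r big_seq big1 ?addr0// => i.
  by rewrite mem_rem_uniq ?iota_uniq// inE => /andP[/negPf ->]; rewrite scale0r.
by move=> h; apply: le_trans h (ltW (hN _ _)); rewrite leq_maxl.
Qed.

End Synthesis.

(** The generalised limit is taken in each coordinate; finite sums of moduli
    pass to the limit, whence the stability of balls (Fatou's lemma). *)
Lemma ell1_has_limits : has_limits l1.
Proof.
move=> v M vM.
have vMn n i : rnorm (v i n) <= M by rewrite (le_trans (ell1_coord_le _ _)).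
pose l n := ulim (fun i => v i n).
have near n (e : R) : 0 < e -> \forall i \near free_ultrafilter,
    \sum_(0 <= j < n) rnorm (l j - v i j) <= e.
  elim: n e => [|n IH] e e0.
    by apply: nearW => i; rewrite big_nil ltW.
  have e20 : 0 < e / 2 by rewrite divr_gt0.
  apply: filterS2 (IH _ e20) (ulimP (vMn n) e20) => i h1 h2.
  by rewrite big_nat_recr//= (splitr e) lerD// rdistC ltW.
have key (w : nat -> K^o) c n : (\forall i \near \oo,
    \sum_(0 <= j < n) rnorm (v i j - w j) <= c) ->
    \sum_(0 <= j < n) rnorm (l j - w j) <= c.
  move=> h; apply/ler_addgt0Pr => e e0.
  have [i [h1 h2]] := @filter_ex _ free_ultrafilter _ _
    (filterI (near n e e0) (near_free h)).
  rewrite addrC; apply: le_trans (lerD h1 h2); rewrite -big_split /=.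
  by apply: ler_sum => j _; exact: ler_rdist.
have ll : ell1_pred l.
  apply: (@ell1_predP _ M) => n.
  have := key 0 M n; under eq_bigr do rewrite subr0; apply.
  apply: nearW => i; under eq_bigr do rewrite subr0.
  exact: le_trans (ell1_psum_le _ _) (vM i).
exists (Ell1 ll) => w c h; apply: ell1_le => n; apply: key.
by apply: filterS h => i; apply: le_trans; exact: (ell1_psum_le (v i - w)).
Qed.

End Ell1Theory.

(** * Complemented copies of ell1 *)

Section ComplementedEll1.
Variables (R : realType) (s : scalars).
Local Notation K := (scalar_field R s).
Local Notation l1 := (ell1 R s).

(** If [B \o W] is close to the identity of ell1, it has an inverse [U], and
    [W \o U \o B] is a projection onto the range of [W]. *)
Lemma complemented_ell1_of_factor (Z : normedModType K)
    (W : {linear l1 -> Z}) (B : {linear Z -> l1}) (MW MB : R) :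
  (forall a, rnorm (W a) <= MW * rnorm a) ->
  (forall z, rnorm (B z) <= MB * rnorm z) ->
  (forall a, rnorm (a - B (W a)) <= 2^-1 * rnorm a) ->
  contains_complemented_copy l1 Z.
Proof.
move=> hW hB hBW.
have lN : linear (fun a : l1 => a - B (W a)).
  by move=> k a b; rewrite (linearP W) (linearP B) scalerBr opprD addrACA.
have /choice[U hU] : forall b, exists x, B (W x) = b /\ rnorm x <= 2 * rnorm b.
  move=> b; have [x xb xn] := neumann b (@ell1_has_limits R s) lN hBW.
  by exists x; split=> //; rewrite -xb subKr.
have BU b : B (W (U b)) = b by have [] := hU b.
have BWinj a b : B (W a) = B (W b) -> a = b.
  move=> ab; apply/subr0_eq/rnorm_eq0/eqP; rewrite eq_le rnorm_ge0 andbT.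
  have := hBW (a - b); rewrite (linearB W) (linearB B) ab subrr subr0 => h.
  by have := rnorm_ge0 (a - b); lra.
have UB a : U (B (W a)) = a by apply: BWinj; rewrite BU.
have lS : linear (fun z => U (B z)).
  move=> k x y; apply: BWinj.
  by rewrite BU (linearP B) (linearP W) (linearP B) !BU.
have Sh z : rnorm (U (B z)) <= 2 * MB * rnorm z.
  have [_ h] := hU (B z); apply: le_trans h _.
  by rewrite -mulrA ler_wpM2l.
have lP : linear (fun z => W (U (B z))).
  by move=> k x y; have := lS k x y; rewrite /= => ->; rewrite linearP.
have MW0 x : rnorm (W x) <= `|MW| * rnorm x.
  by apply: le_trans (hW x) _; rewrite ler_wpM2r ?rnorm_ge0// ler_norm.
have Ph z : rnorm (W (U (B z))) <= `|MW| * (2 * MB) * rnorm z.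
  by apply: le_trans (MW0 _) _; rewrite -[leRHS]mulrA ler_wpM2l.
have cP := continuous_rnorm_le lP Ph.
have rP : range W = [set z | z - W (U (B z)) = 0].
  apply/seteqP; split=> [_ [a _ <-]|z /= /subr0_eq zz].
    by rewrite /= UB subrr.
  by exists (U (B z)).
exists (range W), W, (fun z => U (B z)), (linear_map lP); split.
- rewrite rP.
  have cD : continuous (fun z => z - W (U (B z))).
    by move=> z; apply: cvgB; [exact: cvg_id|exact: cP].
  have -> : [set z | z - W (U (B z)) = 0] =
      (fun z => z - W (U (B z))) @^-1` [set 0] by [].
  apply: closed_comp => [z _|]; first exact: cD.
  exact: (accessible_closed_set1 (hausdorff_accessible (@norm_hausdorff _ _))).
- split=> //.
  + by move=> x; exact: (continuous_rnorm_le (linearP W) hW).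
  + by apply: continuous_subspaceT => x; exact: (continuous_rnorm_le lS Sh).
split.
- apply/seteqP; split=> [_ [z _ <-]|_ [a _ <-]] /=.
    by exists (U (B z)).
  by exists (W a) => //=; rewrite UB.
- by move=> x /=; rewrite UB.
- exact: cP.
Qed.

End ComplementedEll1.

(** Rosenthal's disjointification lemma.  Split the integers into infinitely
    many infinite sets.  Either one of them is as wanted, or each contains an
    index [k] whose row has mass more than [e] inside that set and off [k];
    the rows of the matrix restricted to these indices have then lost a mass
    [e], and induction on the bound of the row sums applies. *)
Lemma rosenthal (R : realDomainType) (e : R) (N : nat) (m : nat -> nat -> R) :
  0 <= e -> (forall i j, 0 <= m i j) ->
  (forall i t, uniq t -> \sum_(j <- t) m i j <= N%:R * e) ->
  exists2 f : nat -> nat, injective f &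
    forall i t, uniq t -> i \notin t -> \sum_(j <- t) m (f i) (f j) <= e.
Proof.
move=> e0; elim: N m => [|N IH] m m0 mN.
  exists id => // i t ut _; apply: le_trans (mN i t ut) _.
  by rewrite mul0r.
pose c (p i : nat) : nat := pickle (p, i).
have c_inj p q i j : c p i = c q j -> p = q /\ i = j.
  by move=> /(pcan_inj (@pickleK _))[-> ->].
(* the p-th set of the partition is the range of [c p] *)
have [[p hp]|no] := pselect (exists p, forall i t, uniq t -> i \notin t ->
    \sum_(j <- t) m (c p i) (c p j) <= e).
  by exists (c p) => // i j /c_inj[].
have /choice[g hg] : forall p, exists g : nat * seq nat, [/\ uniq g.2,
    g.1 \notin g.2 & e < \sum_(j <- g.2) m (c p g.1) (c p j)].
  move=> p; apply: contrapT => nog; apply: no; exists p => i t ut it.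
  by rewrite leNgt; apply/negP => h; apply: nog; exists (i, t).
pose k p := c p (g p).1.
have k_inj : injective k by move=> p q /c_inj[].
have [||f f_inj hf] := IH (fun p q => m (k p) (k q)).
- by move=> *; exact: m0.
- move=> p t ut; have [ug pg eg] := hg p.
  have := mN (k p) (map k t ++ map (c p) (g p).2).
  rewrite cat_uniq !map_inj_uniq// ?ut ?ug//=; last by move=> i j /c_inj[].
  rewrite andbT big_cat !big_map /= -natr1 mulrDl mul1r => h.
  rewrite -(lerD2r e); apply: le_trans (h _); first by rewrite lerD2l ltW.
  apply/hasPn => _ /mapP[i ig ->]; apply/mapP => -[q _] /c_inj[pq iq].
  by move: ig; rewrite iq -pq (negPf pg).
by exists (k \o f) => //; exact: inj_comp.
Qed.

Section BessagaPelczynski.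
Variables (R : realType) (s : scalars).
Local Notation K := (scalar_field R s).
Local Notation l1 := (ell1 R s).

(** After Bessaga and Pelczynski.  The [Y j] define an operator into ell1 whose
    diagonal on the [z n] is bounded below.  Rosenthal's lemma selects indices
    for which the off-diagonal part is at most half of the diagonal, and the
    renormalised vectors [w k] are mapped close to the unit vectors. *)
Lemma complemented_ell1_of_functionals (Z : normedModType K)
    (Y : nat -> dual Z) (z : nat -> Z) (C M d : R) :
  has_limits Z -> 0 <= C ->
  (forall x t, uniq t -> \sum_(j <- t) rnorm (Y j x) <= C * rnorm x) ->
  (forall n, rnorm (z n) <= M) ->
  0 < d -> (forall n, d <= rnorm (Y n (z n))) ->
  contains_complemented_copy l1 Z.
Proof.
move=> hZ C0 YC zM d0 Yd.
have e0 : 0 < d / 2 by rewrite divr_gt0.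
pose N := (Num.trunc (C * M / (d / 2))).+1.
have [|||f f_inj hf] := @rosenthal R (d / 2) N (fun i j => rnorm (Y j (z i))).
- exact: ltW.
- by move=> *; exact: rnorm_ge0.
- move=> i t ut; apply: le_trans (YC _ _ ut) _.
  apply: (@le_trans _ _ (C * M)); first by rewrite ler_wpM2l.
  by rewrite -ler_pdivrMr// ltW// truncnS_gt.
have Bsum x n : \sum_(0 <= i < n) rnorm (Y (f i) x) <= C * rnorm x.
  have := YC x (map f (index_iota 0 n)).
  by rewrite map_inj_uniq// iota_uniq big_map => /(_ isT).
pose b x : l1 := Ell1 (ell1_predP (Bsum x)).
have lb : linear b by move=> k x y; apply: ell1_eq => i; exact: linearP.
pose B := linear_map lb.
have hB x : rnorm (B x) <= C * rnorm x by apply: ell1_le => n; exact: Bsum.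
have Y0 n : 0 < rnorm (Y n (z n)) by exact: lt_le_trans (Yd n).
pose w k := (Y (f k) (z (f k)))^-1 *: z (f k).
have hw k : rnorm (w k) <= d^-1 * M.
  rewrite rnormZ rnormV ler_pM ?invr_ge0 ?rnorm_ge0//.
  by rewrite lef_pV2 ?posrE.
have [W [Wd hW]] := ell1_synthesis hZ hw.
have hr k : rnorm (ell1_delta R s k - B (w k)) <= 2^-1.
  apply: ell1_le => n.
  have E i : rnorm ((ell1_delta R s k - B (w k)) i) =
      if i == k then 0
      else (rnorm (Y (f k) (z (f k))))^-1 * rnorm (Y (f i) (z (f k))).
    rewrite ell1BE ell1_deltaE /= linearZ /= /GRing.scale /=.
    case: eqP => [->|_].
      rewrite mulVf ?subrr ?rnorm_scalar0//.
      by have := Y0 (f k); rewrite rnorm_gt0.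
    by rewrite sub0r rnormN rnormM rnormV.
  under eq_bigr do rewrite E -if_neg.
  rewrite -big_mkcond /= -mulr_sumr -big_filter.
  rewrite mulrC ler_pdivrMr//; apply: (@le_trans _ _ (d / 2)).
    by apply: hf; rewrite ?filter_uniq ?iota_uniq// mem_filter eqxx.
  by rewrite mulrC ler_wpM2l.
have [T [Td hT]] := ell1_synthesis (@ell1_has_limits R s) hr.
apply: (complemented_ell1_of_factor hW hB) => a.
suff <- : T a = a - B (W a) by exact: hT.
have lD : linear (fun a : l1 => a - B (W a)).
  by move=> k x y; rewrite (linearP W) (linearP B) scalerBr opprD addrACA.
apply: (@ell1_ext _ _ _ T (linear_map lD) 2^-1 (1 + C * (d^-1 * M))) => //.
  move=> x /=; apply: le_trans (ler_rnormB _ _) _.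
  rewrite mulrDl mul1r lerD2l; apply: le_trans (hB _) _.
  by rewrite -mulrA ler_wpM2l.
by move=> n /=; rewrite Td Wd.
Qed.

End BessagaPelczynski.

(** * Simons' inequality *)

Section Simons.
Variables (R : realType) (X : Type) (x0 : X).
Implicit Types (f g : X -> R).

Let s f := sup (range f).

Let s_ub f (B : R) x : (forall y, f y <= B) -> f x <= s f.
Proof.
move=> fB; apply: sup_upper_bound; last by exists x.
by split; [exists (f x0), x0|exists B => _ [y _ <-]].
Qed.

Let s_le f (B : R) : (forall y, f y <= B) -> s f <= B.
Proof.
by move=> fB; apply: sup_le_ub => [|_ [y _ <-]//]; exists (f x0), x0.
Qed.

Let s_gt f (c : R) : c < s f -> exists x, c < f x.
Proof.
by move=> /(sup_gt _)[|_ [x _ <-] cx]; [exists (f x0), x0|exists x].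
Qed.

Variables (C : nat -> set (X -> R)) (M d : R).
Hypotheses (C_dec : forall k, C k.+1 `<=` C k)
  (C_mid : forall k f g, C k f -> C k g -> C k (fun x => (f x + g x) / 2))
  (C_ge0 : forall k g x, C k g -> 0 <= g x)
  (C_le : forall k g x, C k g -> g x <= M)
  (C_ex : forall k, C k !=set0)
  (C_sup : forall g, C 0%N g -> exists x, d <= g x)
  (d0 : 0 < d).

Let p k : R := 2^-1 ^+ k.
Let p0 k : 0 < p k. Proof. by rewrite exprn_gt0. Qed.
Let pS k : p k.+1 = p k / 2. Proof. by rewrite /p exprSr. Qed.
Let M0 : 0 <= M.
Proof.
by have [g Cg] := C_ex 0; exact: le_trans (C_ge0 x0 Cg) (C_le x0 Cg).
Qed.

Let e := d / 4.

(* The infimum over [C k] is attained up to an error small with respect to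
   the weight [p k]. *)
Let near_inf k f : exists g, (forall x, 0 <= f x <= M) ->
  C k g /\ forall g', C k g' ->
    s (fun x => f x + p k * g x) <=
    s (fun x => f x + p k * g' x) + e / 2 * p k ^+ 2.
Proof.
have [h|h] := pselect (forall x, 0 <= f x <= M); last by exists f.
pose A := [set s (fun x => f x + p k * g x) | g in C k].
have A0 : A !=set0.
  by have [g Cg] := C_ex k; exists (s (fun x => f x + p k * g x)), g.
have Alb : has_lbound A.
  exists 0 => _ [g Cg <-].
  have gB y : f y + p k * g y <= M + p k * M.
    by have /andP[_ h2] := h y; rewrite lerD// ler_pM2l// (C_le _ Cg).
  apply: le_trans (s_ub x0 gB); have /andP[h1 _] := h x0.
  by rewrite addr_ge0// mulr_ge0// ?(C_ge0 _ Cg)// ltW.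
have ep : 0 < e / 2 * p k ^+ 2 by rewrite mulr_gt0 ?exprn_gt0// !divr_gt0.
have [_ [g Cg <-] gi] := inf_adherent ep (conj A0 Alb).
exists g => _; split=> // g' Cg'; apply: le_trans (ltW gi) _.
by rewrite lerD2r; apply: (inf_lbound Alb); exists g'.
Qed.

(** Simons' inequality.  In the application [C k] is the convex hull of the
    functions of index at least [k] in a sequence, and the conclusion says
    that the sequence cannot tend to 0 at a generalised limit of the points
    [x m].

    Choose [g k] in [C k] so that [S k + p k * g k] nearly has the least
    possible supremum, where [S k] is the sum of the [p j.+1 * g j] for
    [j < k].  Convexity of the remainders of the series shows that this
    supremum hardly exceeds the limit [sigma] of the suprema of the [S k].
    Since [S k.+1] is the midpoint of [S k] and [S k + p k * g k], each step
    closes hardly more than half of the gap between [sigma] and the supremum of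
    [S k], so that this gap stays above [p k * (sigma - e)].  At a point [x m]
    where [S m] is nearly maximal, the terms of index at least [k] must fill
    this gap, so one of them is large. *)
Lemma simons : exists (g : nat -> X -> R) (x : nat -> X),
  (forall k, C k (g k)) /\
  forall k, exists K, \forall m \near \oo,
    exists2 j, (k <= j < K)%N & d / 2 < g j (x m).
Proof.
have /choice[step hstep] : forall kf : nat * (X -> R), exists g,
    (forall x, 0 <= kf.2 x <= M) ->
    C kf.1 g /\ forall g', C kf.1 g' ->
      s (fun x => kf.2 x + p kf.1 * g x) <=
      s (fun x => kf.2 x + p kf.1 * g' x) + e / 2 * p kf.1 ^+ 2.
  by move=> [k f]; exact: near_inf.
pose S := fix S k : X -> R := if k is k'.+1 then
  fun x => S k' x + p k'.+1 * step (k', S k') x else fun=> 0.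
pose g k := step (k, S k).
have SS k x : S k.+1 x = S k x + p k.+1 * g k x by [].
have Sb k x : 0 <= S k x <= M * (1 - p k).
  elim: k x => [|k IH] x; first by rewrite /= /p expr0 subrr mulr0 lexx.
  have IH' y : 0 <= S k y <= M.
    have /andP[-> h] := IH y; apply: le_trans h _.
    by rewrite -[leRHS]mulr1 ler_wpM2l// lerBlDr lerDl ltW.
  have [Cg _] := hstep (k, S k) IH'; have /andP[h1 h2] := IH x.
  rewrite SS addr_ge0//; last by rewrite mulr_ge0// ?(C_ge0 _ Cg)// ltW.
  apply: le_trans (lerD h2 _) _.
    exact: (ler_wpM2l (ltW (p0 _)) (C_le x Cg)).
  by rewrite pS; lra.
have SM k x : 0 <= S k x <= M.
  have /andP[-> h] := Sb k x; apply: le_trans h _.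
  by rewrite -[leRHS]mulr1 ler_wpM2l// lerBlDr lerDl ltW.
have Cg k : C k (g k) by have [] := hstep (k, S k) (SM k).
have gmin k g' : C k g' -> s (fun x => S k x + p k * g k x) <=
    s (fun x => S k x + p k * g' x) + e / 2 * p k ^+ 2.
  by have [_] := hstep (k, S k) (SM k); exact.
(* the remainder S m - S k, completed by a multiple of an element of C m, is
   p k times a convex combination of elements of C k *)
have conv k m f : (k <= m)%N -> C m f ->
    exists2 h, C k h & forall x, S k x + p k * h x = S m x + p m * f x.
  move=> /subnK <-; elim: (m - k)%N f => [|n IH] f Cf; first by exists f.
  have [|h Ch hE] := IH (fun x => (g (n + k)%N x + f x) / 2).
    by apply: C_mid; [exact: Cg|exact: C_dec].
  exists h => // x; rewrite hE addSn SS pS; by field.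
have C0 k : C k `<=` C 0%N.
  by elim: k => // k IH f /C_dec/IH.
have sM k : s (S k) <= M by apply: s_le => y; have /andP[] := SM k y.
have S_le k x : S k x <= s (S k).
  by apply: (@s_ub _ M) => y; have /andP[] := SM k y.
pose A := range (fun k => s (S k)).
have A_ub : has_sup A.
  by split; [exists (s (S 0%N)), 0%N|exists M => _ [k _ <-]].
pose sigma := sup A.
have le_sigma k : s (S k) <= sigma by apply: sup_upper_bound => //; exists k.
have p_small (c : R) : 0 < c -> exists k, p k * M < c.
  move=> c0; have M1 : 0 < M + 1 by rewrite ltr_wpDl.
  have := @cvg_expr R 2^-1; rewrite gtr0_norm// invf_lt1// ltr1n => /(_ isT).
  move=> /cvgrPdist_lt/(_ _ (divr_gt0 c0 M1))[k _ /(_ k (leqnn k))].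
  rewrite /= sub0r normrN ger0_norm ?exprn_ge0// ltr_pdivlMr// => h.
  exists k; apply: le_lt_trans h.
  by rewrite ler_wpM2l ?exprn_ge0// lerDl.
have p_dec k m : (k <= m)%N -> p m <= p k.
  move=> km; rewrite /p ler_wiXn2l//.
  by rewrite invf_le1// ler1n.
have d_sigma : d <= sigma.
  apply/ler_addgt0Pr => c /p_small[k kc]; have [f Cf] := C_ex k.
  have [h Ch hE] := conv 0%N k f (leq0n _) Cf.
  have [x dx] := C_sup (C0 0%N _ Ch).
  have := hE x; rewrite /= add0r /p expr0 mul1r => hx.
  have h1 := S_le k x; have h2 := le_sigma k.
  have h3 := C_le x Cf; have h4 : p k * f x <= p k * M by rewrite ler_pM2l.
  rewrite /p in h4 kc *; lra.
(* S k.+1 is the midpoint of S k and S k + p k * g k *)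
have half k : 2 * s (S k.+1) <= s (S k) + s (fun x => S k x + p k * g k x).
  rewrite mulrC -ler_pdivlMr//; apply: s_le => x.
  rewrite SS ler_pdivlMr// pS.
  have h1 := S_le k x.
  have h2 : S k x + p k * g k x <= s (fun x => S k x + p k * g k x).
    apply: (@s_ub (fun x => S k x + p k * g k x) (M + p k * M)) => y.
    by have /andP[_ h] := SM k y; rewrite lerD// ler_pM2l// (C_le _ (Cg k)).
  lra.
have next k : s (fun x => S k x + p k * g k x) <= sigma + e / 2 * p k ^+ 2.
  apply/ler_addgt0Pr => c /p_small[m mc].
  have pmc : p (maxn k m) * M < c.
    by apply: le_lt_trans mc; rewrite ler_wpM2r// p_dec// leq_maxr.
  have [f Cf] := C_ex (maxn k m).
  have [h Ch hE] := conv k _ f (leq_maxl k m) Cf.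
  apply: le_trans (gmin k h Ch) _.
  rewrite addrAC lerD2r; apply: s_le => x; rewrite hE lerD//.
    exact: le_trans (S_le _ _) (le_sigma _).
  apply: le_trans (ltW pmc); rewrite ler_pM2l//; exact: C_le Cf.
have gap k : p k * (sigma - e) + e * p k ^+ 2 <= sigma - s (S k).
  elim: k => [|k IH].
    have h : s (S 0%N) <= 0 by exact: s_le.
    by rewrite /p expr0 expr1n; lra.
  have h1 := half k; have h2 := next k; rewrite pS.
  have -> : p k / 2 * (sigma - e) + e * (p k / 2) ^+ 2 =
    (p k * (sigma - e) + e * p k ^+ 2) / 2 - e / 2 * p k ^+ 2 / 2 by field.
  by rewrite -/(e) in IH *; lra.
have /choice[x hx] : forall m, exists x, s (S m) - p m < S m x.
  by move=> m; apply: s_gt; rewrite ltrBlDr ltrDl.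
exists g, x; split=> // k.
have c0 : 0 < p k * (d / 16) by rewrite mulr_gt0// divr_gt0.
have [K' hK'] := p_small _ c0.
pose K := maxn k K'.
have hK : p K * M < p k * (d / 16).
  by apply: le_lt_trans hK'; rewrite ler_wpM2r// p_dec// leq_maxr.
exists K.
have [_ [N _ <-] hN] := sup_adherent c0 A_ub.
have S_nd i j y : (i <= j)%N -> S i y <= S j y.
  move=> /subnK <-; elim: (j - i)%N => // n IH; apply: le_trans IH _.
  by rewrite addSn SS lerDl mulr_ge0// ?(C_ge0 _ (Cg _))// ltW.
have tail m y : (K <= m)%N -> S m y <= S K y + (p K - p m) * M.
  move=> /subnK <-; elim: (m - K)%N => [|n IH]; first by rewrite add0n; lra.
  rewrite addSn SS pS.
  have := C_le y (Cg (n + K)%N); have := p0 (n + K); move: IH.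
  set a := S _ y; set b := g _ y; set q := p (n + K) => IH q0 ba.
  have : q / 2 * b <= q / 2 * M by rewrite ler_pM2l// divr_gt0.
  lra.
have [J2 hJ2] : exists J2, p J2 < p k * (d / 16).
  have := @cvg_expr R 2^-1; rewrite gtr0_norm// invf_lt1// ltr1n => /(_ isT).
  move=> /cvgrPdist_lt/(_ _ c0)[j _ /(_ j (leqnn j))].
  rewrite /= sub0r normrN ger0_norm ?exprn_ge0// => h.
  by exists j.
exists (maxn N (maxn K J2)) => // m /= Nm.
have {}Nm : [/\ (N <= m)%N, (K <= m)%N & (J2 <= m)%N].
  by move: Nm; rewrite !geq_max => /andP[-> /andP[-> ->]].
have [Nm1 Km J2m] := Nm.
apply: contrapT => nex.
have gs j : (k <= j < K)%N -> g j (x m) <= d / 2.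
  by move=> jK; rewrite leNgt; apply/negP => h; apply: nex; exists j.
have mid n : (k + n <= K)%N -> S (k + n)%N (x m) <=
    S k (x m) + (p k - p (k + n)%N) * (d / 2).
  elim: n => [|n IH] kn; first by rewrite addn0; lra.
  have := IH (leq_trans _ kn); rewrite leq_add2l leqnSn => /(_ isT).
  have := gs (k + n)%N; rewrite leq_addr -addnS kn => /(_ isT).
  rewrite addnS SS pS; have := p0 (k + n).
  set a := S (k + n)%N _; set b := g _ _; set q := p _ => q0 ba IH'.
  have : q / 2 * b <= q / 2 * (d / 2) by rewrite ler_pM2l// divr_gt0.
  lra.
have := mid (K - k)%N; rewrite subnKC ?leq_maxl// => /(_ (leqnn _)).
have h1 := tail m (x m) Km; have h2 := hx m; have h3 := gap k.
have h4 := S_le k (x m).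
have h5 : s (S N) <= s (S m).
  by apply: s_le => y; apply: le_trans (S_nd _ _ _ Nm1) (S_le _ _).
have h6 := p_dec _ _ J2m.
have h7 : 0 <= p m * M by rewrite mulr_ge0// ltW.
have h8 : 0 <= p K * (d / 2) by rewrite mulr_ge0// ltW// divr_gt0.
have h9 : 0 <= e * p k ^+ 2 by rewrite mulr_ge0 ?sqr_ge0// ltW// divr_gt0.
have h10 : p k * d <= p k * sigma by rewrite ler_pM2l.
rewrite /e in h3 h9; rewrite -/sigma in hN; move: (p0 k) => pk0.
have h11 : 0 < p k * d by rewrite mulr_gt0.
by rewrite mulrBl; lra.
Qed.

End Simons.

(** * Weakly null sequences *)

Section Subsequences.
Variables (R : realType) (s : scalars).
Local Notation K := (scalar_field R s).

Lemma not_cvg_subseq (V : normedModType K) (u : nat -> V) (l : V) :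
  ~ (u @ \oo --> l) -> exists d : R, exists2 f : nat -> nat,
  {homo f : m n / (m < n)%N} & 0 < d /\ forall n, d <= rnorm (u (f n) - l).
Proof.
move=> nul; have [d d0 hd] : exists2 d : R, 0 < d &
    forall N, exists2 n, (N <= n)%N & d <= rnorm (u n - l).
  apply: contrapT => no; apply: nul; apply/cvgn_rnormP => e e0.
  apply: contrapT => noN; apply: no; exists e => // N.
  apply: contrapT => non; apply: noN; exists N => n Nn.
  by rewrite ltNge; apply/negP => h; apply: non; exists n.
have /choice[h hh] : forall N, exists n, (N <= n)%N /\ d <= rnorm (u n - l).
  by move=> N; have [n Nn dn] := hd N; exists n.
pose f := fix f k := if k is k'.+1 then h (f k').+1 else h 0%N.
exists d, f; last by split=> // -[|n]; exact: (hh _).2.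
apply: (homo_ltn ltn_trans) => n.
exact: (hh (f n).+1).1.
Qed.

Lemma homo_ltn_ge (f : nat -> nat) n :
  {homo f : m n / (m < n)%N} -> (n <= f n)%N.
Proof. by move=> hf; elim: n => // n /leq_ltn_trans; apply; exact: hf. Qed.

Lemma weak_cvg_subseq (V : normedModType K) (u : nat -> V) (l : V) f :
  {homo f : m n / (m < n)%N} -> weak_cvg u l -> weak_cvg (u \o f) l.
Proof.
move=> hf ul h; apply/cvgn_rnormP => e e0.
have /cvgn_rnormP/(_ e e0)[N hN] := ul h.
by exists N => n Nn; apply: hN; apply: leq_trans Nn _; exact: homo_ltn_ge.
Qed.

End Subsequences.

Section WeaklyNullFunctionals.
Variables (R : realType) (s : scalars).
Local Notation K := (scalar_field R s).

(** Convex combinations of the moduli of a weakly null sequence of functionals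
    tend to 0 uniformly on the unit ball; Mazur's theorem alone would only
    give this without the moduli.  Otherwise Simons' inequality yields points
    [x m] of the ball, and the generalised limit of the evaluations at the
    [x m] is an element of the bidual on which the sequence does not tend
    to 0. *)
Lemma weakly_null_abs_convex (E : normedModType K) (f : nat -> dual E)
    (M d : R) :
  (forall n, rnorm (f n) <= M) -> weak_cvg f 0 -> 0 < d ->
  exists t : seq (R * nat), [/\ forall p, p \in t -> 0 <= p.1,
    \sum_(p <- t) p.1 = 1 &
    forall x, \sum_(p <- t) p.1 * rnorm (f p.2 x) <= d * rnorm x].
Proof.
move=> fM f0 d0; apply: contrapT => no.
have M0 : 0 <= M by exact: le_trans (rnorm_ge0 _) (fM 0%N).
pose X := {x : E | rnorm x <= 1}.
have x0P : rnorm (0 : E) <= 1 by rewrite rnorm0.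
pose x0 : X := exist _ 0 x0P.
pose C k : set (X -> R) := [set g | exists t : seq (R * nat),
  [/\ forall p, p \in t -> 0 <= p.1 /\ (k <= p.2)%N,
      \sum_(p <- t) p.1 = 1 &
      g = fun x => \sum_(p <- t) p.1 * rnorm (f p.2 (sval x))]].
have [|||||_ [t [tp t1 ->]]||g [x [gC hx]]] := @simons R X x0 C M d.
- move=> k _ [t [tp t1 ->]]; exists t; split=> // p /tp[-> kp].
  by split=> //; exact: ltnW.
- move=> k _ _ [t [tp t1 ->]] [t' [t'p t'1 ->]].
  exists (map (fun p => (p.1 / 2, p.2)) (t ++ t')); split.
  + move=> p /mapP[q]; rewrite mem_cat => /orP[/tp|/t'p] [q0 kq] -> /=;
      by rewrite divr_ge0.
  + by rewrite big_map -mulr_suml big_cat /= t1 t'1 (_ : 1 + 1 = 2)// mulfV.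
  + apply/funext => x; rewrite big_map -big_cat mulr_suml /=.
    by apply: eq_bigr => p _; rewrite mulrAC.
- move=> k _ x [t [tp _ ->]]; rewrite big_seq sumr_ge0// => p /tp[p0 _].
  by rewrite mulr_ge0 ?rnorm_ge0.
- move=> k _ [x xle] [t [tp t1 ->]] /=.
  rewrite -[leRHS]mul1r -t1 mulr_suml !big_seq ler_sum// => p /tp[p0 _].
  rewrite ler_wpM2l//; apply: le_trans (ler_dual _ _) _.
  by rewrite -[leRHS]mulr1 ler_pM ?rnorm_ge0.
- move=> k; exists (fun x => rnorm (f k (sval x))), [:: (1, k)].
  split; first by move=> p; rewrite inE => /eqP ->.
    by rewrite big_seq1.
  by apply/funext => x; rewrite big_seq1 mul1r.
- apply: contrapT => nx; apply: no; exists t.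
  split=> [p /tp[]//|//|x].
  have [->|x0'] := eqVneq x 0.
    rewrite rnorm0 mulr0 big1// => p _.
    by rewrite linear0 rnorm_scalar0 mulr0.
  have nx0 : 0 < rnorm x by rewrite rnorm_gt0.
  have ex : rnorm (of_real s (rnorm x)^-1 : K^o) = (rnorm x)^-1.
    by rewrite rnorm_of_real gtr0_norm// invr_gt0.
  have yP : rnorm (of_real s (rnorm x)^-1 *: x) <= 1.
    by rewrite rnormZ ex mulVf// gt_eqF.
  rewrite -ler_pdivrMr// leNgt; apply/negP => h; apply: nx.
  exists (exist (fun x : E => rnorm x <= 1) _ yP) => /=.
  apply: le_trans (ltW h) _.
  rewrite mulr_suml ler_sum// => p _.
  by rewrite linearZ rnormZ ex mulrA [leRHS]mulrAC.
- exact: d0.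
have fxM n m : rnorm (f n (sval (x m))) <= M.
  apply: le_trans (ler_dual _ _) _.
  by rewrite -[leRHS]mulr1 ler_pM ?rnorm_ge0//; exact: (svalP (x m)).
pose h (u : dual E) := ulim (fun m => u (sval (x m))).
have uxM (u : dual E) m : rnorm (u (sval (x m))) <= rnorm u.
  apply: le_trans (ler_dual _ _) _.
  by rewrite -[leRHS]mulr1 ler_wpM2l ?rnorm_ge0//; exact: (svalP (x m)).
have lh : linear h.
  move=> k u v; rewrite /h -(@ulim_linear _ _ _ _ _ (rnorm u) (rnorm v)).
  - by congr ulim; apply/funext.
  - exact: uxM.
  - exact: uxM.
have hM u : rnorm (h u) <= 1 * rnorm u.
  by rewrite mul1r; apply: rnorm_ulim; exact: uxM.
have d40 : 0 < d / 4 by rewrite divr_gt0.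
have /cvgn_rnormP/(_ _ d40)[N hN] := f0 (Dual (dual_predP lh hM)).
have [k hk] := hx N.
have small n : (N <= n)%N -> \forall m \near free_ultrafilter,
    rnorm (f n (sval (x m))) <= d / 2.
  move=> Nn; have := hN n Nn; rewrite linear0 subr0 /= => hn.
  apply: filterS (ulimP (uxM (f n)) d40) => m hm.
  apply: le_trans (ler_rnorm_sub _ (h (f n))) _.
  by rewrite (_ : d / 2 = d / 4 + d / 4) ?lerD ?(ltW hn) ?(ltW hm)//; field.
have smallg j : (N <= j)%N -> \forall m \near free_ultrafilter,
    g j (x m) <= d / 2.
  move=> Nj; have [t [tp t1 gE]] := gC j.
  have : \forall m \near free_ultrafilter, forall p, p \in t ->
      rnorm (f p.2 (sval (x m))) <= d / 2.
    have {}tp p : p \in t -> (N <= p.2)%N.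
      by move=> /tp[_ jp]; exact: leq_trans jp.
    elim: t tp {t1 gE} => [|p t IH] tp.
      by apply: nearW => m p; rewrite in_nil.
    have IH' := IH (fun q qt => tp q (@mem_behead _ (p :: t) q qt)).
    have hp := small p.2 (tp p (mem_head _ _)).
    apply: filterS2 hp IH' => m h1 h2 q; rewrite inE => /orP[/eqP ->//|].
    exact: h2.
  apply: filterS => m hm; rewrite gE.
  apply: (@le_trans _ _ (\sum_(p <- t) p.1 * (d / 2))).
    rewrite !big_seq ler_sum// => p pt; have [p0 _] := tp p pt.
    by rewrite ler_wpM2l// hm.
  by rewrite -mulr_suml t1 mul1r.
have smallall : \forall m \near free_ultrafilter,
    forall j, (N <= j < k)%N -> g j (x m) <= d / 2.
  elim: (k) => [|k' IH]; first by apply: nearW => m j; rewrite ltn0 andbF.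
  have [Nk|kN] := leqP N k'; last first.
    apply: nearW => m j /andP[Nj]; rewrite ltnS => /(leq_trans Nj).
    by rewrite leqNgt kN.
  apply: filterS2 IH (smallg _ Nk) => m h1 h2 j; rewrite ltnS (leq_eqVlt j).
  by move=> /andP[Nj /orP[/eqP ->//|jk]]; apply: h1; rewrite Nj.
have [m [h1 [j jk h2]]] := @filter_ex _ free_ultrafilter _ _
  (filterI smallall (near_free hk)).
by have := h1 j jk; rewrite leNgt h2.
Qed.

End WeaklyNullFunctionals.

(** * Functionals on the projective tensor product *)

Section ProjectiveTensorProduct.
Variables (R : realType) (s : scalars).
Local Notation K := (scalar_field R s).
Variables (E F G : completeNormedModType K) (tau : {bilinear E -> F -> G}).
Hypothesis tauP : projective_tensor_product tau.

Let sum_tau (t : seq (E * F)) : G := \sum_(p <- t) tau p.1 p.2.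

Let projective_norm_lb (t : seq (E * F)) :
  lbound [set \sum_(p <- t') rnorm p.1 * rnorm p.2 | t' in same_tensor t] 0.
Proof.
by move=> _ [t' _ <-]; apply: sumr_ge0 => p _; rewrite mulr_ge0 ?rnorm_ge0.
Qed.

Lemma rnorm_tau (x : E) (y : F) : rnorm (tau x y) <= rnorm x * rnorm y.
Proof.
have := ptp_norm tauP [:: (x, y)]; rewrite big_seq1 /= => ->.
apply: inf_lbound; first by exists 0; exact: projective_norm_lb.
by exists [:: (x, y)]; rewrite ?big_seq1.
Qed.

Lemma ptp_approx (z : G) (e : R) : 0 < e ->
  exists t, rnorm (z - sum_tau t) < e.
Proof.
move=> e0; have ke : 0 < of_real s e by rewrite -(of_real0 R s) ltr_of_real.
have [||w [zt [t _ tE]]] := ptp_dense tauP (O := ball z (of_real s e)).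
- by exists z; exact: ballxx.
- exact: ball_open.
exists t; rewrite -tE in zt; move: zt; rewrite -ball_normE /=.
by rewrite -of_real_rnorm ltr_of_real.
Qed.

(** The projective norm is an infimum over the representations of a tensor,
    all of which give the same value of [phi]. *)
Lemma ptp_bound (phi : seq (E * F) -> R) (M : R) : 0 <= M ->
  (forall t t', same_tensor t t' -> phi t = phi t') ->
  (forall t, phi t <= M * \sum_(p <- t) rnorm p.1 * rnorm p.2) ->
  forall t, phi t <= M * rnorm (sum_tau t).
Proof.
move=> M0 phiE phiM t; rewrite /sum_tau (ptp_norm tauP) /projective_norm.
apply/ler_addgt0Pr => e e0; have M1 : 0 < M + 1 by rewrite ltr_wpDl.
have [||_ [t' tt' <-] h] := @inf_adherent R
  [set \sum_(p <- t') rnorm p.1 * rnorm p.2 | t' in same_tensor t]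
  (e / (M + 1)) _ _.
- by rewrite divr_gt0.
- split; last by exists 0; exact: projective_norm_lb.
  by exists (\sum_(p <- t) rnorm p.1 * rnorm p.2), t.
rewrite (phiE _ _ tt'); apply: le_trans (phiM t') _.
apply: le_trans (ler_wpM2l M0 (ltW h)) _; rewrite mulrDr lerD2l.
apply: (@le_trans _ _ ((M + 1) * (e / (M + 1)))).
  by rewrite ler_wpM2r ?lerDl// ltW// divr_gt0.
by rewrite mulrC divfK ?gt_eqF.
Qed.

Lemma ptp_dual_le (g : dual G) (M : R) : 0 <= M ->
  (forall x y, rnorm (g (tau x y)) <= M * (rnorm x * rnorm y)) ->
  rnorm g <= M.
Proof.
move=> M0 gM.
have gt t : rnorm (g (sum_tau t)) <= M * rnorm (sum_tau t).
  apply: (@ptp_bound (fun t => rnorm (g (sum_tau t)))) => // [t1 t2 t12|t'].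
    by rewrite /sum_tau (t12 _ tau).
  rewrite /sum_tau linear_sum; apply: le_trans (ler_rnorm_sum _ _) _.
  by rewrite mulr_sumr ler_sum// => p _; exact: gM.
apply: dual_le => // z; apply/ler_addgt0Pr => e e0.
have gM1 : 0 < rnorm g + M + 1 by rewrite ltr_wpDl// addr_ge0 ?rnorm_ge0.
have [t zt] := ptp_approx z (divr_gt0 e0 gM1).
have h1 := ler_rnorm_sub (g z) (g (sum_tau t)).
have h2 := ler_dual g (z - sum_tau t); rewrite linearB in h2.
have h3 := gt t.
have h4 := ler_rnorm_sub (sum_tau t) z; rewrite (rdistC (sum_tau t)) in h4.
have h5 : M * rnorm (sum_tau t) <= M * (rnorm z + rnorm (z - sum_tau t)).
  by rewrite ler_wpM2l.
have h6 : (rnorm g + M + 1) * rnorm (z - sum_tau t) <= e.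
  by rewrite mulrC -ler_pdivlMr// ltW.
have h7 := rnorm_ge0 (z - sum_tau t).
move: h1 h2 h3 h5 h6 h7; set a := rnorm (z - _) => *; lra.
Qed.

Section Extension.
Variables (b : {bilinear E -> F -> K^o}) (M : R).
Hypotheses (M0 : 0 <= M)
  (bM : forall x y, rnorm (b x y) <= M * (rnorm x * rnorm y)).

Let sum_b (t : seq (E * F)) : K^o := \sum_(p <- t) b p.1 p.2.

Let bt t : rnorm (sum_b t) <= M * rnorm (sum_tau t).
Proof.
apply: (@ptp_bound (fun t => rnorm (sum_b t))) => // [t1 t2 t12|t'].
  by rewrite /sum_b (t12 _ b).
rewrite /sum_b; apply: le_trans (ler_rnorm_sum _ _) _.
by rewrite mulr_sumr ler_sum// => p _; exact: bM.
Qed.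

Let comb (k : K) (t t' : seq (E * F)) := map (fun p => (k *: p.1, p.2)) t ++ t'.

Let comb_tau k t t' : sum_tau (comb k t t') = k *: sum_tau t + sum_tau t'.
Proof.
rewrite /sum_tau /comb big_cat big_map /= scaler_sumr; congr (_ + _).
by apply: eq_bigr => p _; rewrite linearZl_LR.
Qed.

Let comb_b k t t' : sum_b (comb k t t') = k *: sum_b t + sum_b t'.
Proof.
rewrite /sum_b /comb big_cat big_map /= scaler_sumr; congr (_ + _).
by apply: eq_bigr => p _; rewrite linearZl_LR.
Qed.

Let bB t t' : rnorm (sum_b t - sum_b t') <= M * rnorm (sum_tau t - sum_tau t').
Proof.
have := bt (comb (-1) t' t); rewrite comb_b comb_tau !scaleN1r.
by rewrite [- sum_b _ + _]addrC [- sum_tau _ + _]addrC.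
Qed.

(** The universal property: a bounded bilinear form is well defined and bounded
    on the algebraic tensor product, hence extends to its completion. *)
Lemma ptp_extend : exists g : dual G, forall x y, g (tau x y) = b x y.
Proof.
have : forall z : G, exists l : K^o, forall t,
    rnorm (l - sum_b t) <= M * rnorm (z - sum_tau t).
  move=> z.
  have pos i : 0 < i.+1%:R^-1 :> R by rewrite invr_gt0.
  have /choice[T hT] : forall i : nat, exists t,
      rnorm (z - sum_tau t) < i.+1%:R^-1 by move=> i; exact: ptp_approx.
  have [|l hl] := @has_limits_cvg R s K^o (fun i => sum_b (T i))
      (fun i => M * (2 * i.+1%:R^-1)) (@scalar_has_limits R s).
    move=> i j ij; apply: le_trans (bB _ _) _; rewrite ler_wpM2l//.
    apply: le_trans (ler_rdist _ z _) _; rewrite mulr2n mulrDl mul1r lerD//.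
      rewrite rdistC (le_trans (ltW (hT j)))// lef_pV2 ?posrE//.
      by rewrite ler_nat.
    exact: ltW.
  exists l => t; apply/ler_addgt0Pr => e e0.
  have M1 : 0 < 3 * M + 1 by rewrite ltr_wpDl// mulr_ge0.
  pose i := Num.trunc ((3 * M + 1) / e).
  have hi : (3 * M + 1) * i.+1%:R^-1 <= e.
    by rewrite ler_pdivrMr// [leRHS]mulrC -ler_pdivrMr// ltW// truncnS_gt.
  apply: le_trans (ler_rdist _ (sum_b (T i)) _) _.
  have h1 := hl i; have h2 := bB (T i) t.
  have h3 := ler_rdist (sum_tau (T i)) z (sum_tau t).
  have h4 := ltW (hT i); rewrite rdistC in h4.
  have h5 : M * rnorm (sum_tau (T i) - sum_tau t) <=
      M * (i.+1%:R^-1 + rnorm (z - sum_tau t)).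
    by rewrite ler_wpM2l// (le_trans h3)// lerD2r.
  have := pos i; move: h1 h2 h5 hi; rewrite /=.
  set q := i.+1%:R^-1 => *; lra.
move=> /choice[g hg].
have lg : linear g.
  move=> k z z'; apply: eq_of_rnorm => e e0.
  have k1 : 0 <= rnorm (k : K^o) by exact: rnorm_ge0.
  have B1 : 0 < 2 * M * (rnorm (k : K^o) + 1) + 1.
    by rewrite ltr_wpDl// mulr_ge0 ?mulr_ge0// addr_ge0.
  have e1 := divr_gt0 e0 B1.
  have [t zt] := ptp_approx z e1; have [t' zt'] := ptp_approx z' e1.
  have h1 := hg (k *: z + z') (comb k t t'); rewrite comb_b comb_tau in h1.
  have h2 := hg z t; have h3 := hg z' t'.
  have zz : rnorm (k *: z + z' - (k *: sum_tau t + sum_tau t')) <=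
      rnorm (k : K^o) * rnorm (z - sum_tau t) + rnorm (z' - sum_tau t').
    rewrite opprD addrACA -scalerBr; apply: le_trans (ler_rnormD _ _) _.
    by rewrite rnormZ.
  have gg : rnorm (k *: g z + g z' - (k *: sum_b t + sum_b t')) <=
      rnorm (k : K^o) * rnorm (g z - sum_b t) + rnorm (g z' - sum_b t').
    rewrite opprD addrACA -scalerBr; apply: le_trans (ler_rnormD _ _) _.
    by rewrite rnormZ.
  apply: le_trans (ler_rdist _ (k *: sum_b t + sum_b t') _) _.
  rewrite [X in _ + X]rdistC; apply: le_trans (lerD h1 gg) _.
  set c := rnorm (k : K^o) in k1 B1 e1 zt zt' zz gg *.
  set a := rnorm (z - sum_tau t) in h2 zt zz *.
  set a' := rnorm (z' - sum_tau t') in h3 zt' zz *.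
  set q := e / _ in e1 zt zt'.
  have qe : (2 * M * (c + 1) + 1) * q = e by rewrite mulrC divfK// gt_eqF.
  have z1 : M * (rnorm (k *: z + z' - (k *: sum_tau t + sum_tau t'))) <=
    M * (c * q + q).
    rewrite ler_wpM2l//; apply: le_trans zz _; rewrite lerD//; last exact: ltW.
    by rewrite ler_wpM2l// ltW.
  have z2 : c * rnorm (g z - sum_b t) <= c * (M * q).
    rewrite ler_wpM2l//; apply: le_trans h2 _; rewrite ler_wpM2l//.
    exact: ltW.
  have z3 : rnorm (g z' - sum_b t') <= M * q.
    by apply: le_trans h3 _; rewrite ler_wpM2l// ltW.
  rewrite -qe; lra.
have gM z : rnorm (g z) <= M * rnorm z.
  by have := hg z [::]; rewrite /sum_b /sum_tau !big_nil !subr0.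
exists (Dual (dual_predP lg gM)) => x y /=.
have := hg (tau x y) [:: (x, y)]; rewrite /sum_b /sum_tau !big_seq1 /= subrr.
rewrite rnorm0 mulr0 => h; apply/subr0_eq/rnorm_eq0/eqP.
by rewrite eq_le rnorm_ge0 andbT.
Qed.

End Extension.

Section TensorOfFunctionals.
Variables (f : dual E) (u : dual F).

Let form (x : E) (y : F) : K^o := f x * u y.

Let form_bilinear : bilinear_for
  (GRing.Scale.Law.clone K K^o *:%R _) (GRing.Scale.Law.clone K K^o *:%R _)
  form.
Proof.
split=> [y|x] k z z' /=; rewrite /form linearP.
  by rewrite mulrDl -scalerAl.
by rewrite mulrDr -scalerAr.
Qed.

Let bform : {bilinear E -> F -> K^o} :=
  HB.pack form (bilinear_isBilinear.Build K E F K^o _ _ form form_bilinear).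

Lemma ptp_tensor : exists g : dual G, forall x y, g (tau x y) = f x * u y.
Proof.
apply: (@ptp_extend bform (rnorm f * rnorm u)) => [|x y].
  by rewrite mulr_ge0 ?rnorm_ge0.
rewrite /= /form rnormM mulrACA ler_pM ?rnorm_ge0//; exact: ler_dual.
Qed.

End TensorOfFunctionals.

(** Suppose that some [psi] is bounded below on the [g n].  By convexity it is
    bounded below on convex combinations of the [g n], up to unimodular
    factors.  Such a combination has, as a bilinear form, a norm controlled by
    the supremum over the ball of the same combination of the moduli of the
    [f n], which can be made small. *)
Lemma weakly_null_tensor (f : nat -> dual E) (u : nat -> dual F)
    (g : nat -> dual G) (Mf Mu : R) :
  (forall n, rnorm (f n) <= Mf) -> weak_cvg f 0 ->
  (forall n, rnorm (u n) <= Mu) ->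
  (forall n x y, g n (tau x y) = f n x * u n y) ->
  weak_cvg g 0.
Proof.
move=> fM f0 uM gE psi; apply: contrapT => nc.
have [d [a a_homo [d0 hd]]] := not_cvg_subseq nc.
have Mu0 : 0 <= Mu by exact: le_trans (rnorm_ge0 _) (uM 0%N).
have B0 : 0 < rnorm psi * Mu + 1 by rewrite ltr_wpDl// mulr_ge0 ?rnorm_ge0.
have [|||t [t0 t1 tx]] := @weakly_null_abs_convex R s E (f \o a) Mf
    (d / 2 / (rnorm psi * Mu + 1)).
- by move=> n; exact: fM.
- exact: weak_cvg_subseq f0.
- by rewrite !divr_gt0.
set e := d / 2 / _ in tx.
have e0 : 0 <= e by rewrite ltW// !divr_gt0.
have h1 : d <= \sum_(p <- t) rnorm (psi (of_real s p.1 *: g (a p.2))).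
  rewrite -[leLHS]mul1r -t1 mulr_suml !big_seq ler_sum// => p pt.
  rewrite linearZ rnormZ rnorm_of_real ger0_norm ?t0// ler_wpM2l ?t0//.
  by have := hd p.2; rewrite linear0 subr0.
have h2 : \sum_(p <- t) rnorm (psi (of_real s p.1 *: g (a p.2))) <=
    rnorm psi * (e * Mu).
  apply: sum_rnorm_functional => c c1.
  apply: ptp_dual_le => [|x y]; first by rewrite mulr_ge0.
  rewrite dual_sumE; apply: le_trans (ler_rnorm_sum _ _) _.
  apply: (@le_trans _ _ ((\sum_(p <- t) p.1 * rnorm (f (a p.2) x)) *
      (Mu * rnorm y))); last first.
    rewrite mulrACA; apply: ler_wpM2r (tx x).
    by rewrite mulr_ge0 ?rnorm_ge0.
  rewrite mulr_suml !big_seq ler_sum// => p pt.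
  rewrite !dualZE !rnormZ gE rnormM rnorm_of_real ger0_norm ?t0//.
  rewrite -[leRHS]mul1r ler_pM ?rnorm_ge0//.
    by rewrite !mulr_ge0 ?rnorm_ge0 ?t0.
  rewrite -mulrA !ler_wpM2l ?t0 ?rnorm_ge0//; apply: le_trans (ler_dual _ _) _.
  by rewrite ler_wpM2r ?rnorm_ge0.
have eB : e * (rnorm psi * Mu + 1) = d / 2 by rewrite divfK// gt_eqF.
lra.
Qed.

End ProjectiveTensorProduct.

(** * Contraction of bilinear forms by functionals *)

Section PhiSequence.
Variables (R : realType) (s : scalars).
Local Notation K := (scalar_field R s).

Variables (E F G : completeNormedModType K) (tau : {bilinear E -> F -> G}).
Hypothesis tauP : projective_tensor_product tau.

Section Slice.
Variables (g : dual G) (x : E).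

Let slice_fun (y : F) : K^o := g (tau x y).

Let slice_linear : linear slice_fun.
Proof. by move=> k y y'; rewrite /slice_fun linearPr linearP. Qed.

Let slice_bound y : rnorm (slice_fun y) <= rnorm g * rnorm x * rnorm y.
Proof.
apply: le_trans (ler_dual _ _) _.
by rewrite -mulrA ler_wpM2l ?rnorm_ge0// (rnorm_tau tauP).
Qed.

Definition slice : dual F := Dual (dual_predP slice_linear slice_bound).

Lemma rnorm_slice : rnorm slice <= rnorm g * rnorm x.
Proof.
by apply: dual_le => [|y]; [rewrite mulr_ge0 ?rnorm_ge0|exact: slice_bound].
Qed.

End Slice.

Section Contract.
Variable v : dual (dual F).

Let contract_fun (g : dual G) (x : E) : K^o := v (slice g x).

Let contract_linear_r g : linear (contract_fun g).
Proof.
move=> k x y; rewrite /contract_fun -linearP; congr (v _).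
by apply: dual_eq => z; rewrite /= /slice /= linearPl linearP.
Qed.

Let contract_bound g x :
  rnorm (contract_fun g x) <= rnorm v * rnorm g * rnorm x.
Proof.
apply: le_trans (ler_dual _ _) _.
by rewrite -mulrA ler_wpM2l ?rnorm_ge0 ?rnorm_slice.
Qed.

Definition contract_map (g : dual G) : dual E :=
  Dual (dual_predP (contract_linear_r g) (contract_bound g)).

Let contract_linear : linear contract_map.
Proof.
move=> k g h; apply: dual_eq => x.
change (v (slice (k *: g + h) x) = k *: v (slice g x) + v (slice h x)).
by rewrite -linearP; congr (v _); apply: dual_eq.
Qed.

Definition contract : {linear dual G -> dual E} := linear_map contract_linear.

Lemma rnorm_contract g : rnorm (contract g) <= rnorm v * rnorm g.
Proof.
by apply: dual_le => [|x]; [rewrite mulr_ge0 ?rnorm_ge0|exact: contract_bound].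
Qed.

Definition adjoint_contract (z : dual (dual E)) : dual (dual G) :=
  dual_comp rnorm_contract z.

Let adjoint_contract_linear : linear adjoint_contract.
Proof. by move=> k z w; apply: dual_eq. Qed.

Lemma rnorm_adjoint_contract z :
  rnorm (adjoint_contract z) <= rnorm v * rnorm z.
Proof.
apply: dual_le => [|g]; first by rewrite mulr_ge0 ?rnorm_ge0.
by rewrite [rnorm v * _]mulrC; exact: (dual_comp_le rnorm_contract z g).
Qed.

(** Second adjoint of the contraction by [v]: it carries the bidual of the
    space of bilinear forms to the third dual of [E]. *)
Definition bidual_contract (xi : dual (dual (dual G))) : dual (dual (dual E)) :=
  @dual_comp R s _ _ (linear_map adjoint_contract_linear) _
    rnorm_adjoint_contract xi.

End Contract.

(** A functional [xi] bounded below on infinitely many terms of this sequence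
    would yield, through the second adjoints of the contractions
    by the [v n], a weakly unconditionally Cauchy series in the third dual of
    [E] that is bounded below at the points [dual_eval (x n)] of the bidual;
    the bidual would then contain a complemented copy of ell1. *)
Lemma weakly_null_contract (v : nat -> dual (dual F)) (x : nat -> E) (C : R) :
  0 <= C ->
  (forall h t, uniq t -> \sum_(j <- t) rnorm (v j h) <= C * rnorm h) ->
  (forall n, rnorm (x n) <= 1) ->
  ~ contains_complemented_copy (ell1 R s) (dual (dual E)) ->
  weak_cvg (fun n => adjoint_contract (v n) (dual_eval (x n))) 0.
Proof.
move=> C0 vC x1 noell xi; apply: contrapT => nc.
have [d [a a_homo [d0 hd]]] := not_cvg_subseq nc.
have a_inj : injective a.
  move=> m n amn; apply/eqP.
  by case: ltngtP => // /a_homo; rewrite amn ltnn.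
apply: noell; apply: (@complemented_ell1_of_functionals R s (dual (dual E))
  (fun j => bidual_contract (v (a j)) xi) (fun n => dual_eval (x (a n)))
  (rnorm xi * C) 1 d) => //.
- exact: dual_has_limits.
- by rewrite mulr_ge0 ?rnorm_ge0.
- move=> z t ut; rewrite -mulrA; apply: sum_rnorm_functional => c c1.
  apply: dual_le => [|g]; first by rewrite mulr_ge0 ?rnorm_ge0.
  have -> : (\sum_(j <- t) c j *: adjoint_contract (v (a j)) z) g =
      z (\sum_(j <- t) c j *: contract (v (a j)) g).
    rewrite dual_sumE linear_sum; apply: eq_bigr => j _.
    by rewrite linearZ.
  apply: le_trans (ler_dual _ _) _; rewrite mulrAC mulrC.
  rewrite ler_wpM2r ?rnorm_ge0//; apply: dual_le => [|y].
    by rewrite mulr_ge0 ?rnorm_ge0.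
  rewrite dual_sumE; apply: le_trans (ler_rnorm_sum _ _) _.
  apply: (@le_trans _ _ (\sum_(j <- t) rnorm (v (a j) (slice g y)))).
    apply: ler_sum => j _; rewrite dualZE rnormZ -[leRHS]mul1r.
    by rewrite ler_wpM2r ?rnorm_ge0.
  have := vC (slice g y) (map a t); rewrite map_inj_uniq// big_map => /(_ ut) h.
  apply: le_trans h _; rewrite -mulrA ler_wpM2l//.
  exact: rnorm_slice.
- by move=> n; exact: le_trans (rnorm_dual_eval _) (x1 _).
- by move=> n; have := hd n; rewrite linear0 subr0.
Qed.

End PhiSequence.

(** * Weak topologies *)

Section WeakTopology.
Variables (R : realType) (s : scalars).
Local Notation K := (scalar_field R s).
Variable V : normedModType K.

Let emb (x : V) : {ptws dual V -> K^o} := fun f => f x.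

Lemma weak_space_cvg (F : set_system (weak_space V)) (x : weak_space V) :
  Filter F ->
  (forall f : dual V, (fun y : weak_space V => f y) @ F --> f x) -> F --> x.
Proof.
move=> FF Fx.
have : (emb : weak_space V -> _) @ F --> emb x by apply/pointwise_cvgP.
move=> h A /= [_ [[B Bop <-] Bfs] sBfA].
have nB : nbhs (emb x) B by exact: open_nbhs_nbhs.
by apply: (@filterS _ F _ _ _ sBfA); exact: h nB.
Qed.

Lemma weak_space_eval (f : dual V) :
  continuous ((fun y => f y) : weak_space V -> K^o).
Proof.
move=> x; have c : continuous (emb : weak_space V -> _).
  exact: initial_continuous.
exact: (cvg_comp _ _ (c x) (@proj_continuous _ (fun=> K^o) f (emb x))).
Qed.

Lemma weak_space_hausdorff :
  (forall x y : V, (forall f : dual V, f x = f y) -> x = y) ->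
  hausdorff_space (weak_space V).
Proof.
move=> sep p q pq; apply: sep => f; apply: eq_of_rnorm => e e0.
have e20 : 0 < e / 2 by rewrite divr_gt0.
have N x : nbhs (x : weak_space V) [set y | rnorm (f y - f x) < e / 2].
  by have /cvg_rnormP/(_ _ e20) := @weak_space_eval f x.
have [y [/= yp yq]] := pq _ _ (N p) (N q).
rewrite rdistC in yp; apply: le_trans (ler_rdist _ (f y) _) _.
by rewrite (splitr e) lerD// ltW.
Qed.

End WeakTopology.

Section UltraLimitFunctionals.
Variables (R : realType) (s : scalars).
Local Notation K := (scalar_field R s).

(** Banach-Alaoglu, for a family of functionals indexed by the carrier of an
    ultrafilter. *)
Lemma dual_ball_ultra (V : normedModType K) (T : choiceType) (G : set_system T)
    (X : T -> dual V) :
  UltraFilter G -> (forall t, rnorm (X t) <= 1) ->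
  exists2 xi : dual V, rnorm xi <= 1 &
    forall x (e : R), 0 < e -> \forall t \near G, rnorm (X t x - xi x) < e.
Proof.
move=> GU X1.
have Xx t x : rnorm (X t x) <= rnorm x.
  apply: le_trans (ler_dual _ _) _.
  by rewrite -[leRHS]mul1r ler_wpM2r ?rnorm_ge0.
have /choice[l hl] : forall x, exists l : K^o, forall e : R, 0 < e ->
    \forall t \near G, rnorm (X t x - l) < e.
  move=> x; apply: (@ultra_cvg_scalar R T G GU s (fun t => X t x) (rnorm x)).
  by apply: nearW => t; exact: Xx.
have ll : linear l.
  move=> k x y; apply: eq_of_rnorm => e e0.
  have k1 : 0 < rnorm (k : K^o) + 1 by rewrite ltr_wpDl ?rnorm_ge0.
  have e30 : 0 < e / 3 by rewrite divr_gt0.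
  have [t [h1 [h2 h3]]] := @filter_ex _ G _ _ (filterI (hl (k *: x + y) _ e30)
    (filterI (hl x _ (divr_gt0 e30 k1)) (hl y _ e30))).
  have h4 : rnorm (X t (k *: x + y) - (k *: l x + l y)) <=
      rnorm (k : K^o) * rnorm (X t x - l x) + rnorm (X t y - l y).
    rewrite linearP opprD addrACA -scalerBr.
    by apply: le_trans (ler_rnormD _ _) _; rewrite rnormZ.
  have h5 : rnorm (k : K^o) * rnorm (X t x - l x) <= e / 3.
    apply: (@le_trans _ _ ((rnorm (k : K^o) + 1) * rnorm (X t x - l x))).
      by rewrite ler_wpM2r ?rnorm_ge0// lerDl.
    by rewrite mulrC -ler_pdivlMr// ltW.
  apply: le_trans (ler_rdist _ (X t (k *: x + y)) _) _.
  by rewrite rdistC in h1; lra.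
have lM x : rnorm (l x) <= 1 * rnorm x.
  rewrite mul1r; apply/ler_addgt0Pr => e /(hl x)/filter_ex[t ht].
  apply: le_trans (ler_rnorm_sub _ (X t x)) _.
  by rewrite rdistC lerD// ltW.
exists (Dual (dual_predP ll lM)) => [|x e]; first exact: dual_le.
exact: hl.
Qed.

End UltraLimitFunctionals.

Section DualEll1.
Variables (R : realType) (s : scalars).
Local Notation K := (scalar_field R s).
Local Notation l1 := (ell1 R s).
Local Notation delta := (ell1_delta R s).

Lemma dual_ell1_trunc (b : dual l1) (a : l1) N :
  b (ell1_trunc a N) = \sum_(0 <= n < N) a n * b (delta n).
Proof.
rewrite /ell1_trunc linear_sum; apply: eq_bigr => n _.
by rewrite linearZ.
Qed.

Lemma dual_ell1_le (b : dual l1) (a : l1) (B : R) :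
  (forall m, \sum_(0 <= n < m) rnorm (a n : K^o) * rnorm (b (delta n)) <= B) ->
  rnorm (b a) <= B.
Proof.
move=> aB; apply/ler_addgt0Pr => e e0.
have b1 : 0 < rnorm b + 1 by rewrite ltr_wpDl ?rnorm_ge0.
have [N hN] := @ell1_trunc_cvg R s a _ (divr_gt0 e0 b1).
apply: le_trans (ler_rnorm_sub _ (b (ell1_trunc a N))) _; rewrite lerD//.
  rewrite dual_ell1_trunc; apply: le_trans (ler_rnorm_sum _ _) _.
  by apply: le_trans (aB N); apply: ler_sum => n _; rewrite rnormM.
rewrite -linearB; apply: le_trans (ler_dual _ _) _.
apply: (@le_trans _ _ ((rnorm b + 1) * rnorm (a - ell1_trunc a N))).
  by rewrite ler_wpM2r ?rnorm_ge0// lerDl.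
by rewrite mulrC -ler_pdivlMr// ltW.
Qed.

Section Coordinates.
Variable n : nat.

Let coord_linear : linear (fun a : l1 => a n : K^o). Proof. by []. Qed.

Let coord_bound (a : l1) : rnorm (a n) <= 1 * rnorm a.
Proof. by rewrite mul1r ell1_coord_le. Qed.

Definition ell1_coord : dual l1 := Dual (dual_predP coord_linear coord_bound).

End Coordinates.

(** The functionals [b] with [b (delta n)] tending to 0 form a copy of c0 in the
    dual of ell1, in which the coordinate functionals span a dense subspace;
    the values of [L] at the coordinates are summable and determine it there. *)
Lemma c0_functional (L : dual (dual l1)) : exists l : l1, forall b : dual l1,
  (fun n => b (delta n)) @ \oo --> 0 -> L b = b l.
Proof.
pose l n : K^o := L (ell1_coord n).
have lL N : \sum_(0 <= n < N) rnorm (l n) <= rnorm L.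
  rewrite -[leRHS]mulr1; apply: sum_rnorm_functional => c c1.
  apply: dual_le => // a; rewrite dual_sumE mul1r.
  apply: le_trans (ler_rnorm_sum _ _) _.
  apply: le_trans (ell1_psum_le a N); apply: ler_sum => n _.
  by rewrite dualZE rnormZ -[leRHS]mul1r ler_wpM2r ?rnorm_ge0.
exists (Ell1 (ell1_predP lL)) => b b0; apply: eq_of_rnorm => e e0.
set l' : l1 := Ell1 _.
have B0 : 0 < 2 * rnorm L + 1 by rewrite ltr_wpDl// mulr_ge0 ?rnorm_ge0.
have e1 := divr_gt0 e0 B0; set d := e / _ in e1.
have /cvgn_rnormP/(_ _ e1)[N hN] := b0.
pose bN : dual l1 := \sum_(0 <= n < N) b (delta n) *: ell1_coord n.
have bNa a : bN a = \sum_(0 <= n < N) b (delta n) * a n.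
  by rewrite /bN dual_sumE; apply: eq_bigr.
have LbN : L bN = \sum_(0 <= n < N) b (delta n) * l n.
  by rewrite /bN linear_sum; apply: eq_bigr => n _; rewrite linearZ.
have bNl : L bN = bN l' by rewrite LbN bNa.
have bbN : rnorm (b - bN) <= d.
  apply: dual_le => [|a]; first exact: ltW.
  apply: dual_ell1_le => m.
  apply: (@le_trans _ _ (\sum_(0 <= n < m) rnorm (a n) * d)); last first.
    by rewrite -mulr_suml mulrC ler_wpM2l ?ell1_psum_le// ltW.
  apply: ler_sum => n _; rewrite ler_wpM2l ?rnorm_ge0//.
  have -> : (b - bN) (delta n) = b (delta n) - bN (delta n) by [].
  have bNn : bN (delta n) = if (n < N)%N then b (delta n) else 0.
    rewrite bNa; have [nN|Nn] := ltnP n N.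
      rewrite (big_rem n) /=; last by rewrite mem_index_iota.
      rewrite eqxx mulr1 big_seq big1 ?addr0// => i.
      rewrite mem_rem_uniq ?iota_uniq// inE => /andP[/negPf -> _].
      by rewrite mulr0.
    rewrite big_nat_cond big1// => i /andP[/andP[_ iN] _] /=.
    by rewrite (ltn_eqF (leq_trans iN Nn)) mulr0.
  rewrite bNn; have [nN|Nn] := ltnP n N.
    by rewrite subrr rnorm_scalar0 ltW.
  by rewrite subr0; have := hN n Nn; rewrite subr0 => /ltW.
have l'L : rnorm l' <= rnorm L by exact: ell1_le.
have -> : L b - b l' = L (b - bN) - (b - bN) l'.
  rewrite (linearB L) /= bNl.
  change (L b - b l' = L b - bN l' - (b l' - bN l')).
  by rewrite opprB addrA subrK.
apply: le_trans (ler_rnormB _ _) _.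
have h1 := ler_dual L (b - bN); have h2 := ler_dual (b - bN) l'.
have h3 : rnorm L * rnorm (b - bN) <= rnorm L * d.
  by rewrite ler_wpM2l ?rnorm_ge0.
have h4 : rnorm (b - bN) * rnorm l' <= d * rnorm L by rewrite ler_pM ?rnorm_ge0.
have : (2 * rnorm L + 1) * d = e by rewrite mulrC divfK// gt_eqF.
by lra.
Qed.

End DualEll1.

(** * Failure of the Dunford-Pettis property *)

Section DunfordPettis.
Variables (R : realType) (s : scalars).
Local Notation K := (scalar_field R s).
Local Notation l1 := (ell1 R s).
Local Notation delta := (ell1_delta R s).

(** The operator witnessing the failure is the map sending [g] to the sequence
    of the [phi n g], with values in the copy of c0 inside the dual of ell1.
    Its second adjoint still takes values in c0, because the [phi n] are weakly
    null; this makes it weakly compact. *)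
Lemma not_dunford_pettis (D : normedModType K) (phi : nat -> dual D)
    (g : nat -> D) (M d : R) :
  (forall n, rnorm (phi n) <= M) -> weak_cvg phi 0 -> weak_cvg g 0 ->
  0 < d -> (forall n, d <= rnorm (phi n (g n))) -> ~ dunford_pettis D.
Proof.
move=> phiM phi0 g0 d0 phid dp.
have [L [Ld LM]] := ell1_synthesis (@dual_has_limits R s D) phiM.
have M0 : 0 <= M by exact: le_trans (rnorm_ge0 _) (phiM 0%N).
have Tl x : linear (fun a : l1 => L a x : K^o).
  by move=> k a b; rewrite linearP.
have Tb x (a : l1) : rnorm (L a x : K^o) <= M * rnorm x * rnorm a.
  apply: le_trans (ler_dual _ _) _; rewrite mulrAC.
  by rewrite ler_wpM2r ?rnorm_ge0.
pose T0 x : dual l1 := Dual (dual_predP (Tl x) (Tb x)).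
have T0l : linear T0.
  by move=> k x y; apply: dual_eq => a; rewrite /T0 /= linearP.
have T0b x : rnorm (T0 x) <= M * rnorm x.
  by apply: dual_le => [|a]; [rewrite mulr_ge0 ?rnorm_ge0|exact: Tb].
pose T : {linear D -> dual l1} := linear_map T0l.
have TE x a : T x a = L a x by [].
(* the image of the bidual unit ball under the second adjoint of T *)
pose C : set (weak_space (dual l1)) := [set b : dual l1 |
  exists2 xi : dual (dual D), rnorm xi <= 1 & forall a, b a = xi (L a)].
have Cc0 (b : dual l1) : C b -> (fun n => b (delta n)) @ \oo --> 0.
  move=> [xi _ bxi]; have := phi0 xi; rewrite linear0.
  by under eq_fun do rewrite -Ld -bxi.
have Ccompact : compact C.
  rewrite compact_ultra => U UU UC.
  have /choice[X hX] : forall b : weak_space (dual l1),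
      exists xi : dual (dual D), rnorm xi <= 1 /\
        (C b -> forall a, (b : dual l1) a = xi (L a)).
    move=> b; have [[xi xi1 bxi]|nC] := pselect (C b); first by exists xi.
    by exists 0; split=> //; rewrite rnorm0.
  have [xi xi1 hxi] :=
    @dual_ball_ultra R s (dual D) _ U X UU (fun t => (hX t).1).
  pose b0 : dual l1 := dual_comp LM xi.
  have b0E a : b0 a = xi (L a) by [].
  exists b0; split; first by exists xi.
  apply: weak_space_cvg => lam; have [l hl] := c0_functional lam.
  have Cb0 : C b0 by exists xi.
  rewrite (hl _ (Cc0 _ Cb0)); apply/cvg_rnormP => e e0.
  apply: filterS2 UC (hxi (L l) e e0) => b Cb.
  by rewrite (hl _ (Cc0 _ Cb)) ((hX b).2 Cb) b0E.
have hausd : hausdorff_space (weak_space (dual l1)).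
  apply: weak_space_hausdorff => b b' bb; apply: dual_eq => a.
  exact: bb (dual_eval a).
have Tw : weakly_compact_op T.
  exists C; last by split=> //; exact: compact_closed.
  move=> _ [x /= x1 <-]; exists (dual_eval x) => //.
  by apply: le_trans (rnorm_dual_eval _) _; rewrite -ball_rnorm.
have Tc : continuous T by exact: continuous_rnorm_le T0l T0b.
have gc : weak_cauchy g.
  move=> f; apply/(@cauchy_rnormP R s K^o) => e e0.
  have e20 : 0 < e / 2 by rewrite divr_gt0.
  have /cvgn_rnormP/(_ _ e20)[N hN] := g0 f; exists N => m n Nm Nn.
  apply: le_lt_trans (ler_rdist _ (f 0) _) _.
  by rewrite (splitr e) ltrD//; [|rewrite rdistC]; exact: hN.
have d20 : 0 < d / 2 by rewrite divr_gt0.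
have /cauchy_rnormP/(_ _ d20)[N hN] := dp (dual l1) T Tc Tw g gc.
have := phi0 (dual_eval (g N)); rewrite linear0.
move=> /cvgn_rnormP/(_ _ d20)[N' hN'].
pose n := maxn N N'.
have h1 := hN n N (leq_maxl _ _) (leqnn _).
have := hN' n (leq_maxr _ _); rewrite subr0 dual_evalE => h2.
have h3 := ler_dual (T (g n) - T (g N)) (delta n).
have h4 : rnorm (T (g n) - T (g N)) * rnorm (delta n) <= d / 2.
  rewrite -[leRHS]mulr1 ler_pM ?rnorm_ge0// ?(ltW h1)//.
  exact: rnorm_ell1_delta.
have h5 := ler_rnorm_sub (phi n (g n)) (phi n (g N)).
have h6 : (T (g n) - T (g N)) (delta n) = phi n (g n) - phi n (g N).
  by rewrite -Ld.
rewrite h6 in h3; have := phid n; lra.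
Qed.

Lemma ell1_uniq_sum_le (a : l1) (t : seq nat) :
  uniq t -> \sum_(j <- t) rnorm (a j : K^o) <= rnorm a.
Proof.
move=> ut; apply: le_trans (ell1_psum_le a (\max_(j <- t) j).+1).
rewrite [leLHS](perm_big
  [seq j <- index_iota 0 (\max_(j <- t) j).+1 | j \in t]).
  rewrite big_filter [leRHS](bigID (mem t)) /= lerDl.
  by rewrite sumr_ge0// => j _; exact: rnorm_ge0.
apply: uniq_perm => //; first by rewrite filter_uniq ?iota_uniq.
move=> j; rewrite mem_filter mem_index_iota ltnS /=.
by have [jt|//] := boolP (j \in t); rewrite leq_bigmax_seq.
Qed.

(** The [u n] are the images of the unit vectors, and the [v n] are the
    coordinates of the projection. *)
Lemma complemented_ell1_biorthogonal (V : normedModType K) :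
  contains_complemented_copy l1 V ->
  exists (u : nat -> V) (v : nat -> dual V) (M C : R),
    [/\ forall n, rnorm (u n) <= M, 0 <= C,
        forall x t, uniq t -> \sum_(j <- t) rnorm (v j x) <= C * rnorm x &
        forall n, v n (u n) = 1].
Proof.
move=> [S [T [Q [P [_ [rT TQ Tc Qc] [rP PP Pc]]]]]].
have TQP x : T (Q (P x)) = P x.
  have : range T (P x) by rewrite rT -rP; exists x.
  by move=> [a _ <-]; rewrite TQ.
have lB : linear (fun x => Q (P x)).
  move=> k x y; apply: (can_inj TQ).
  by rewrite TQP (linearP T) !TQP linearP.
have cB : continuous (linear_map lB).
  have PS x : S (P x) by rewrite -rP; exists x.
  move/subspace_continuousP in Qc; move=> x; apply/cvg_rnormP => e e0.
  have /cvg_rnormP/(_ e e0) h := Qc _ (PS x).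
  by apply: (@filterS _ (nbhs x) _ _ _ _ (Pc x _ h)) => y; apply; exact: PS.
have [C C0 hC] := continuous_linear_rnorm cB.
have [M M0 hM] := continuous_linear_rnorm Tc.
have vb n x : rnorm (Q (P x) n : K^o) <= C * rnorm x.
  exact: le_trans (ell1_coord_le _ _) (hC x).
have vl n : linear (fun x => Q (P x) n : K^o).
  by move=> k x y; have := lB k x y; rewrite /= => ->.
exists (fun n => T (delta n)), (fun n => Dual (dual_predP (vl n) (vb n))), M, C.
split=> // [n|x t ut|n] /=.
- apply: le_trans (hM _) _; rewrite -[leRHS]mulr1 ler_wpM2l//.
  exact: rnorm_ell1_delta.
- by apply: le_trans (hC x); exact: ell1_uniq_sum_le.
- have PT a : P (T a) = T a.
    have : range P (T a) by rewrite rP -rT; exists a.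
    by move=> [x _ <-]; rewrite PP.
  by rewrite PT TQ ell1_deltaE eqxx.
Qed.

End DunfordPettis.

(** Normalising vectors whose norm is bounded below multiplies them by bounded
    scalars, which preserves weak nullity. *)
Lemma not_schur_weakly_null (R : realType) (s : scalars)
    (V : normedModType (scalar_field R s)) :
  ~ schur V ->
  exists2 f : nat -> V, weak_cvg f 0 & forall n, rnorm (f n) = 1.
Proof.
move=> nsch; have [u [x [ux nux]]] : exists (u : nat -> V) (x : V),
    weak_cvg u x /\ ~ (u @ \oo --> x).
  apply: contrapT => no; apply: nsch => u x ux.
  by apply: contrapT => nux; apply: no; exists u, x.
have [d [a a_homo [d0 hd]]] := not_cvg_subseq nux.
have r0 n : 0 < rnorm (u (a n) - x) by exact: lt_le_trans (hd n).
have rV n : rnorm (of_real s (rnorm (u (a n) - x))^-1 : (scalar_field R s)^o) =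
    (rnorm (u (a n) - x))^-1.
  by rewrite rnorm_of_real gtr0_norm// invr_gt0.
exists (fun n => of_real s (rnorm (u (a n) - x))^-1 *: (u (a n) - x));
  last first.
  by move=> n; rewrite rnormZ rV mulVf// gt_eqF.
move=> h; apply/cvgn_rnormP => e e0.
have /(_ h)/cvgn_rnormP/(_ _ (mulr_gt0 d0 e0))[N hN] :=
  weak_cvg_subseq a_homo ux.
exists N => n /hN hn; rewrite linear0 subr0 linearZ rnormZ rV.
rewrite mulrC ltr_pdivrMr// linearB; apply: lt_le_trans hn _.
by rewrite mulrC ler_pM2l.
Qed.

Theorem theorem15 (R : realType) (s : scalars)
    (E F EF : completeNormedModType (scalar_field R s))
    (tau : {bilinear E -> F -> EF}) :
  projective_tensor_product tau ->
  ~ schur (dual E) ->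
  ~ contains_complemented_copy (ell1 R s) (dual (dual E)) ->
  contains_complemented_copy (ell1 R s) (dual F) ->
  ~ dunford_pettis (dual EF).
Proof.
move=> tauP /not_schur_weakly_null[f f0 f1] noell.
move=> /complemented_ell1_biorthogonal[u [v [M [C [uM C0 vC vu]]]]].
have /choice[x hx] : forall n, exists x : E, rnorm x <= 1 /\
    2^-1 < rnorm (f n x).
  move=> n; have [|x x1 hx] := @dual_attain _ _ _ (f n) 2^-1; last by exists x.
  by rewrite f1 invf_lt1// ltr1n.
have /choice[g gE] := fun n => ptp_tensor tauP (f n) (u n).
have vC1 n : rnorm (v n) <= C.
  by apply: dual_le => // h; have := vC h [:: n] isT; rewrite big_seq1.
apply: (@not_dunford_pettis R s (dual EF)
  (fun n => adjoint_contract tauP (v n) (dual_eval (x n))) g C 2^-1) => //.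
- move=> n; apply: le_trans (rnorm_adjoint_contract _ _ _) _.
  rewrite -[leRHS]mulr1 ler_pM ?rnorm_ge0//.
  exact: le_trans (rnorm_dual_eval _) (hx n).1.
- by apply: (weakly_null_contract tauP C0 vC) => // n; exact: (hx n).1.
- by apply: (weakly_null_tensor tauP (Mf := 1) _ f0 uM gE) => n; rewrite f1.
- move=> n; have -> : adjoint_contract tauP (v n) (dual_eval (x n)) (g n) =
      v n (slice tauP (g n) (x n)) by [].
  have -> : slice tauP (g n) (x n) = f n (x n) *: u n.
    by apply: dual_eq => y; exact: gE.
  rewrite linearZ /= vu [_ *: _]mulr1; exact: ltW (hx n).2.
Qed.
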